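(* Let $d,e,r$ be positive integers and $G=G(de,1,r)$. Let $\underline\lambda\in\mathcal{MP}_{r,de}$ with $C_{\underline\lambda}=\langle\varepsilon^{b_{\underline\lambda}}\rangle$, where $b_{\underline\lambda}$ is a divisor of $e$. Let $b'$ be a divisor of $|C_{\underline\lambda}|$, $q=|C_{\underline\lambda}|/b'$, and let $r'$ be the integer with $r=qr'$. Write $\underline\mu=(\lambda^{(0)},\ldots,\lambda^{(db_{\underline\lambda}b'-1)})$, so that $\underline\lambda=(\underline\mu,\ldots,\underline\mu)$ ($q$ times). Let $\underline\eta=(\eta_0,\ldots,\eta_{de-1})\in\mathcal{MP}_{r,de}$, let $g_{\underline\eta}=(z;\sigma)$ be the standard representative of the class of $G$ labelled by $\underline\eta$, with $\sigma=\sigma_1\cdots\sigma_s$ the decomposition into disjoint cycles, and for $1\le j\le s$ let $\xi_j$ be the cycle product of the $j$th cycle of $g_{\underline\eta}$. (i) If there is $0\le u\le de-1$ such that $\eta_u\notin q\star\mathcal P$, or if there is $1\le j\le s$ such that $\xi_j\notin\mathcal U_{db_{\underline\lambda}b'}$, then $\Delta_{\underline\lambda,b'}(g_{\underline\eta})=0$. (ii) Assume that $\eta_u=q\star\eta'_u$ for all $0\le u\le de-1$ and that $\xi_j\in\mathcal U_{db_{\underline\lambda}b'}$ for all $1\le j\le s$. Then $$\Delta_{\underline\lambda,b'}(g_{\underline\eta})=q^{\ell(\underline\eta)}\chi_{\underline\mu}(g'_{\underline\eta}),$$ where $g'_{\underline\eta}\in G(de,1,r')$ has cyclic structure $(\eta'_0,\ldots,\eta'_{de-1})$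 and $\chi_{\underline\mu}$ is the irreducible character of $G(de,1,r')$ labelled by $(\underline\mu,\emptyset,\ldots,\emptyset)\in\mathcal{MP}_{r',de}$.
   Context: $\mathcal U_n$ is the group of complex $n$th roots of unity and $\zeta$ is a fixed generator of $\mathcal U_{de}$. $\mathcal P$ is the set of all partitions and $\mathcal{MP}_{s,n}$ the set of $n$-multipartitions of $s$. For $\pi=(\pi_1,\ldots,\pi_t)\in\mathcal P$, $q\star\pi=(q\pi_1,\ldots,q\pi_t)$ and $\ell(\pi)=t$; $\ell(\underline\eta)=\sum_u\ell(\eta_u)$. $G=G(de,1,r)=\mathcal U_{de}^r\rtimes\mathfrak S_r$, with elements $(z;\sigma)=z\sigma$ and $\sigma^{-1}(z_1,\ldots,z_r)\sigma=(z_{\sigma(1)},\ldots,z_{\sigma(r)})$. $\varepsilon:G\to\mathbb C^\times$, $\varepsilon(z;\sigma)=(z_1\cdots z_r)^d$, is a linear character of order $e$; $N=G(de,e,r)=\ker\varepsilon$. Irreducible modules: for $\underline\lambda=(\lambda^{(0)},\ldots,\lambda^{(de-1)})\in\mathcal{MP}_{r,de}$ put $c_i=|\lambda^{(i)}|$, $C_i=c_0+\cdots+c_{i-1}$, $E_i=\{C_i+1,\ldots,C_i+c_i\}$, $\mathfrak S_c=\prod_i\mathfrak S_{E_i}$, $G_c=\mathcal U_{de}^r\rtimes\mathfrak S_c$. Let $V_{\underline\lambda}=V_{\lambda^{(0)}}\otimes\cdots\otimes V_{\lambda^{(de-1)}}$ be the tensor product of Specht modules, $\mathfrak S_{E_i}$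 acting on the $i$th factor through the order-preserving bijection $E_i\to\{1,\ldots,c_i\}$ and $z\in\mathcal U_{de}^r$ acting by the scalar $\prod_i\prod_{j\in E_i}z_j^i$. Then $W_{\underline\lambda}=\operatorname{Ind}_{G_c}^G(V_{\underline\lambda})$, with representation $\rho_{\underline\lambda}$, is the irreducible $G$-module labelled by $\underline\lambda$. (The same construction is used for $G(de,1,r')$.) Let $\mathcal X_c$ be the set of tuples $X=(X_0,\ldots,X_{de-1})$ of disjoint subsets with union $\{1,\ldots,r\}$ and $|X_i|=c_i$; $t_X\in\mathfrak S_r$ sends $C_i+j$ to the $j$th smallest element of $X_i$. The $t_X$ represent $G/G_c$, so $W_{\underline\lambda}=\bigoplus_X t_X\otimes V_{\underline\lambda}$. $C_{\underline\lambda}=\{\varepsilon^j\mid \varepsilon^j\otimes\rho_{\underline\lambda}\cong\rho_{\underline\lambda}\}$, and $b_{\underline\lambda}$ is the positive divisor of $e$ with $C_{\underline\lambda}=\langle\varepsilon^{b_{\underline\lambda}}\rangle$ (so $|C_{\underline\lambda}|=e/b_{\underline\lambda}$ and $\lambda^{(i+db_{\underline\lambda})}=\lambda^{(i)}$, indices mod $de$). With $b=b_{\underline\lambda}$, $M_{\underline\lambda}$ is the linear automorphism of $W_{\underline\lambda}$ given by $$M_{\underline\lambda}(t_X\otimes v_0\otimes\cdots\otimes v_{de-1})=t_{m(X)}\otimes v_{db}\otimes\cdots\otimes v_{db+de-1},\quad m(X)=(X_{db},\ldots,X_{db+de-1})$$ (indices mod $de$); it has order $|C_{\underline\lambda}|$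 and satisfies $M_{\underline\lambda}\rho_{\underline\lambda}(g)=\varepsilon^{b}(g)\rho_{\underline\lambda}(g)M_{\underline\lambda}$. Put $\Delta_{\underline\lambda,k}(g)=\operatorname{Tr}(M_{\underline\lambda}^k\circ\rho_{\underline\lambda}(g))$. Cyclic structure: for $g=(z;\sigma)\in G$, $\sigma=\sigma_1\cdots\sigma_s$ a product of disjoint cycles (fixed points included as cycles of length 1), the cycle product of the $j$th cycle is the product of the $z_k$ with $k$ in the support of $\sigma_j$. The cyclic structure of $g$ is the multipartition $(\eta_0,\ldots,\eta_{de-1})$ in which each cycle $\sigma_j$ contributes a part equal to its length to $\eta_u$, where $\zeta^u$ is its cycle product; it determines the conjugacy class of $g$ in $G$. The standard representative $g_{\underline\eta}=(z;\sigma)$ is the element of cyclic structure $\underline\eta$ such that $\sigma_j=(L_j+1\ \cdots\ L_j+\ell_j)$ with $L_1=0$, $L_j=\ell_1+\cdots+\ell_{j-1}$ ($\ell_j$ the length of $\sigma_j$), $z_{L_j+1}$ is the cycle product of the $j$th cycle, and $z_k=1$ for all other $k$. *)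

(* Defs.v *)
From HB Require Import structures.
From mathcomp Require Import all_boot all_order all_algebra.
From mathcomp Require Import all_fingroup all_solvable all_field all_character.
Set Implicit Arguments.
Unset Strict Implicit.
Unset Printing Implicit Defensive.
Import GRing.Theory.
Local Open Scope ring_scope.

(* Complex n-th roots of unity, as elements of algC.  The exponent n.-1.+1    *)
(* equals n for n > 0; the case n = 0 is the trivial group.                   *)
Record rootU (n : nat) := RootU { rootU_val :> algC;
                                  rootU_valP : rootU_val ^+ n.-1.+1 == 1 }.
HB.instance Definition _ n := [isSub for @rootU_val n].
HB.instance Definition _ n := [Choice of rootU n by <:].

Section RootU.
Variable n : nat.
Let z0 : algC := sval (C_prim_root_exists (ltn0Sn n.-1)).
Let z0P : (n.-1.+1).-primitive_root z0 := svalP (C_prim_root_exists (ltn0Sn n.-1)).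

Definition rootU_log (x : rootU n) : 'I_n.-1.+1 :=
  sval (prim_rootP z0P (eqP (rootU_valP x))).
Definition rootU_exp (i : 'I_n.-1.+1) : option (rootU n) := insub (z0 ^+ i).
Lemma rootU_logK : pcancel rootU_log rootU_exp.
Proof.
move=> x; rewrite /rootU_exp /rootU_log.
by case: (prim_rootP _ _) => i /= <-; rewrite valK.
Qed.
HB.instance Definition _ := PCanIsCountable rootU_logK.
HB.instance Definition _ : isFinite (rootU n) := PCanIsFinite rootU_logK.

Lemma rootU1P : (1 : algC) ^+ n.-1.+1 == 1. Proof. by rewrite expr1n. Qed.
Lemma rootUMP (x y : rootU n) : (rootU_val x * rootU_val y) ^+ n.-1.+1 == 1.
Proof. by rewrite exprMn (eqP (rootU_valP x)) (eqP (rootU_valP y)) mulr1. Qed.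
Lemma rootUVP (x : rootU n) : (rootU_val x)^-1 ^+ n.-1.+1 == 1.
Proof. by rewrite exprVn (eqP (rootU_valP x)) invr1. Qed.

Definition rootU_one := RootU rootU1P.
Definition rootU_mul x y := RootU (rootUMP x y).
Definition rootU_inv x := RootU (rootUVP x).

Lemma rootU_mulA : associative rootU_mul.
Proof. by move=> x y z; apply: val_inj; rewrite /= mulrA. Qed.
Lemma rootU_mul1 : left_id rootU_one rootU_mul.
Proof. by move=> x; apply: val_inj; rewrite /= mul1r. Qed.
Lemma rootU_mulV : left_inverse rootU_one rootU_inv rootU_mul.
Proof.
move=> x; apply: val_inj; rewrite /= mulVf //.
by apply/eqP=> x0; have := rootU_valP x; rewrite x0 expr0n /= eq_sym oner_eq0.
Qed.
HB.instance Definition _ :=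
  Finite_isGroup.Build (rootU n) rootU_mulA rootU_mul1 rootU_mulV.
End RootU.

(* The group G(n,1,r): the element (z; s) is the monomial matrix sending the  *)
(* basis vector e_k to z_(s k) e_(s k).  Products of permutations are taken   *)
(* in functional order, the opposite of the order of MathComp's 'S_r.         *)
Record wreath (n r : nat) := Wreath { wz : {ffun 'I_r -> rootU n}; ws : 'S_r }.

Section Wreath.
Variables n r : nat.
Let G := wreath n r.
Definition wreath_pair (g : G) := (wz g, ws g).
Definition pair_wreath (p : {ffun 'I_r -> rootU n} * 'S_r) : G := Wreath p.1 p.2.
Lemma wreath_pairK : cancel wreath_pair pair_wreath. Proof. by case. Qed.
HB.instance Definition _ := Equality.copy (wreath n r) (can_type wreath_pairK).
HB.instance Definition _ := Choice.copy (wreath n r) (can_type wreath_pairK).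
HB.instance Definition _ := Countable.copy (wreath n r) (can_type wreath_pairK).
HB.instance Definition _ := Finite.copy (wreath n r) (can_type wreath_pairK).

Definition wreath_mul (g h : G) : G :=
  Wreath [ffun k => (wz g k * wz h ((ws g)^-1 k))%g] (ws h * ws g)%g.
Definition wreath_one : G := Wreath [ffun=> 1%g] 1%g.
Definition wreath_inv (g : G) : G :=
  Wreath [ffun k => (wz g (ws g k))^-1%g] (ws g)^-1%g.

Lemma wreathP (g h : G) : wz g =1 wz h -> ws g =1 ws h -> g = h.
Proof. by case: g h => [z s] [z' s'] /= /ffunP-> /permP->. Qed.

Lemma wreath_mulA : associative wreath_mul.
Proof.
move=> f g h; apply: wreathP => k /=; last by rewrite mulgA.
by rewrite !ffunE invMg permM mulgA.
Qed.
Lemma wreath_mul1 : left_id wreath_one wreath_mul.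
Proof.
by move=> g; apply: wreathP => k /=; rewrite ?mulg1 // !ffunE mul1g invg1 perm1.
Qed.
Lemma wreath_mulV : left_inverse wreath_one wreath_inv wreath_mul.
Proof.
move=> g; apply: wreathP => k /=; last by rewrite mulgV.
by rewrite !ffunE invgK mulVg.
Qed.
HB.instance Definition _ :=
  Finite_isGroup.Build (wreath n r) wreath_mulA wreath_mul1 wreath_mulV.
End Wreath.

Record intpart := IntPart { pval :> seq nat;
                            pvalP : sorted geq pval && (0%N \notin pval) }.
HB.instance Definition _ := [isSub for pval].
HB.instance Definition _ := [Choice of intpart by <:].

Definition empty_part : intpart := @IntPart [::] isT.
Definition psize (p : intpart) : nat := \sum_(i < size p) nth 0%N p i.
Definition qstar (q : nat) (p : intpart) : seq nat := [seq q * x | x <- p]%N.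

(* r is split into consecutive blocks of lengths c 0, c 1, ... and blk Hr j   *)
(* (j in 'I_(c i)) is the j-th point C_i + j of the i-th block E_i; points    *)
(* and blocks are numbered from 0.                                            *)
Section Blocks.
Variables (n r : nat) (c : 'I_n -> nat) (Hr : (\sum_i c i)%N = r).
Implicit Types s t : 'S_r.

Definition blk (i : 'I_n) (j : 'I_(c i)) : 'I_r := cast_ord Hr (@tagnat.Rank n c i j).
Definition blkset (i : 'I_n) : {set 'I_r} := [set blk j | j : 'I_(c i)].
Definition blk_index (k : 'I_r) : 'I_n := tagnat.sig1 (cast_ord (esym Hr) k).
Definition blk_pos (k : 'I_r) : 'I_(c (blk_index k)) :=
  tagnat.sig2 (cast_ord (esym Hr) k).

Definition is_split (X : {ffun 'I_n -> {set 'I_r}}) :=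
  [&& [forall i, forall j, (i != j) ==> [disjoint X i & X j]],
      \bigcup_i X i == setT & [forall i, #|X i| == c i]].

Record split_of := Split { split_val :> {ffun 'I_n -> {set 'I_r}};
                           splitP : is_split split_val }.
HB.instance Definition _ := [isSub for split_val].
HB.instance Definition _ := [Finite of split_of by <:].

Lemma split_disjoint (X : split_of) i j k :
  k \in split_val X i -> k \in split_val X j -> i = j.
Proof.
case: X => X /= /and3P[/forallP dX _ _] Xi Xj; apply/eqP/negPn/negP => nij.
move/forallP/(_ j)/implyP/(_ nij): (dX i) => /pred0P/(_ k) /=.
by rewrite Xi Xj.
Qed.
Lemma split_card (X : split_of) i : #|split_val X i| = c i.
Proof. by case: X => X /= /and3P[_ _ /forallP/(_ i)/eqP]. Qed.
Lemma split_cover (X : split_of) k : exists i, k \in split_val X i.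
Proof.
case: X => X /= /and3P[_ /eqP cX _].
have: k \in \bigcup_i X i by rewrite cX inE.
by case/bigcupP=> i _; exists i.
Qed.

Lemma blkK k : blk (blk_pos k) = k.
Proof. by rewrite /blk tagnat.sig2K cast_ordKV. Qed.
Lemma blk_indexK i (j : 'I_(c i)) : blk_index (blk j) = i.
Proof. by rewrite /blk_index /blk cast_ordK tagnat.Rank1K. Qed.
Lemma blk_posK i (j : 'I_(c i)) : blk_pos (blk j) = j :> nat.
Proof.
have sig2_eq k l : k = l -> @tagnat.sig2 n c k = tagnat.sig2 l :> nat by move=> ->.
by rewrite /blk_pos (sig2_eq _ _ (cast_ordK _ _)) tagnat.Rank2K.
Qed.
Lemma mem_blkset i k : (k \in blkset i) = (blk_index k == i).
Proof.
apply/imsetP/eqP => [[j _ ->]|<-]; first exact: blk_indexK.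
by exists (blk_pos k); rewrite ?blkK.
Qed.
Lemma blk_eq k l :
  blk_index k = blk_index l -> blk_pos k = blk_pos l :> nat -> k = l.
Proof.
move=> ei ep; rewrite -[LHS]blkK -[RHS]blkK.
by apply/val_inj/eqP => /=; rewrite tagnat.eq_Rank ep ei !eqxx.
Qed.
Lemma blk_inj i : injective (@blk i).
Proof.
by move=> j j' e; apply: val_inj => /=; rewrite -(blk_posK j) -(blk_posK j') e.
Qed.

Fact blkset_split : is_split [ffun i => blkset i].
Proof.
apply/and3P; split.
- apply/forallP=> i; apply/forallP=> j; apply/implyP=> nij; rewrite !ffunE.
  apply/pred0P=> k /=; rewrite !mem_blkset.
  by apply/negP=> /andP[/eqP-> /eqP e]; rewrite e eqxx in nij.
- rewrite eqEsubset subsetT; apply/subsetP=> k _; apply/bigcupP.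
  by exists (blk_index k); rewrite // ffunE mem_blkset.
by apply/forallP=> i; rewrite ffunE card_imset ?card_ord //; apply: blk_inj.
Qed.
Definition split0 : split_of := Split blkset_split.

Fact split_act_subproof (s : 'S_r) (X : split_of) :
  is_split [ffun i => s @: split_val X i].
Proof.
apply/and3P; split.
- apply/forallP=> i; apply/forallP=> j; apply/implyP=> nij; rewrite !ffunE.
  apply/pred0P=> k /=; apply/negP=> /andP[/imsetP[u Xu ->] /imsetP[v Xv]].
  move/perm_inj=> e; rewrite e in Xu.
  by rewrite (split_disjoint Xu Xv) eqxx in nij.
- rewrite eqEsubset subsetT; apply/subsetP=> k _; apply/bigcupP.
  have [i Xi] := split_cover X (s^-1%g k).
  by exists i; rewrite // ffunE -[k](permKV s) imset_f.
apply/forallP=> i; rewrite ffunE card_imset ?split_card //; exact: perm_inj.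
Qed.
Definition split_act (s : 'S_r) (X : split_of) : split_of :=
  Split (split_act_subproof s X).

Lemma split_act1 (X : split_of) : split_act 1 X = X.
Proof.
apply/val_inj/ffunP=> i; rewrite ffunE -[RHS]imset_id.
by apply: eq_imset => k; rewrite perm1.
Qed.
Lemma split_actM s t (X : split_of) :
  split_act (s * t) X = split_act t (split_act s X).
Proof.
apply/val_inj/ffunP=> i; rewrite !ffunE -imset_comp.
by apply: eq_imset => k; rewrite permM.
Qed.

Definition tX_fun (X : split_of) (k : 'I_r) : 'I_r :=
  nth k (enum (split_val X (blk_index k))) (blk_pos k).
Lemma tX_fun_in X k : tX_fun X k \in split_val X (blk_index k).
Proof. by rewrite -mem_enum mem_nth // -cardE split_card. Qed.
Fact tX_inj X : injective (tX_fun X).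
Proof.
move=> k l e; have Xk := tX_fun_in X k; have Xl := tX_fun_in X l.
have ei : blk_index k = blk_index l.
  by apply: (split_disjoint (X := X) Xk); rewrite e.
apply: blk_eq => //; move: e; rewrite /tX_fun.
have: (blk_pos k < #|split_val X (blk_index k)|)%N by rewrite split_card.
have: (blk_pos l < #|split_val X (blk_index l)|)%N by rewrite split_card.
move: (blk_pos k : nat) (blk_pos l : nat) => a b.
rewrite ei cardE => ltb lta; rewrite (set_nth_default l) // => /eqP.
by rewrite nth_uniq ?enum_uniq // => /eqP.
Qed.
(* t_X; the enumeration of a set of ordinals is increasing.                   *)
Definition tX (X : split_of) : 'S_r := perm (@tX_inj X).

(* The Young subgroup S_c.                                                    *)
Definition blk_stab : {set 'S_r} :=
  [set s : 'S_r | [forall i, s @: blkset i == blkset i]].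

(* For s in blk_stab, the permutation of 'I_(c i) corresponding to the        *)
(* restriction of s to the i-th block: s (blk j) = blk (blk_perm i s j).      *)
Definition blk_perm (i : 'I_n) (s : 'S_r) : 'S_(c i) :=
  insubd (1%g : 'S_(c i))
         [ffun j : 'I_(c i) => odflt j [pick j' | blk j' == s (blk j)]].

Lemma blk_stabP s :
  reflect (forall k, blk_index (s k) = blk_index k) (s \in blk_stab).
Proof.
rewrite inE; apply: (iffP forallP) => [Hs k | Hs i].
  apply/eqP; rewrite -mem_blkset -(eqP (Hs (blk_index k))).
  by rewrite imset_f // mem_blkset.
rewrite eqEcard card_imset ?leqnn ?andbT; last exact: perm_inj.
apply/subsetP=> _ /imsetP[k Hk ->].
by rewrite mem_blkset Hs -mem_blkset.
Qed.
Lemma blk_stab1 : 1%g \in blk_stab.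
Proof. by apply/blk_stabP => k; rewrite perm1. Qed.
Lemma blk_stabM s t :
  s \in blk_stab -> t \in blk_stab -> (s * t)%g \in blk_stab.
Proof.
by move=> /blk_stabP Hs /blk_stabP Ht; apply/blk_stabP => k; rewrite permM Ht.
Qed.
Lemma blk_stabV s : s \in blk_stab -> s^-1%g \in blk_stab.
Proof.
by move=> /blk_stabP Hs; apply/blk_stabP => k; rewrite -[in RHS](permKV s k) Hs.
Qed.

Lemma blk_permE i s j : s \in blk_stab -> blk (blk_perm i s j) = s (blk j).
Proof.
move=> /blk_stabP Hs.
pose f := [ffun j : 'I_(c i) => odflt j [pick j' | blk j' == s (blk j)]].
have fE j0 : blk (f j0) = s (blk j0).
  rewrite ffunE; case: pickP => [j' /eqP // | no].
  have: s (blk j0) \in blkset i by rewrite mem_blkset Hs blk_indexK.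
  by case/imsetP=> j' _ e; move: (no j'); rewrite e eqxx.
have f_inj : injectiveb f.
  apply/injectiveP=> j1 j2 e; apply: (@blk_inj i); apply: (@perm_inj _ s).
  by rewrite -!fE e.
rewrite -fE; congr blk; rewrite /blk_perm -/f.
have -> : insubd (1%g : 'S_(c i)) f = Perm f_inj.
  by apply: val_inj; rewrite val_insubd f_inj.
by rewrite -pvalE.
Qed.
Lemma blk_perm1 i : blk_perm i 1 = 1%g.
Proof.
apply/permP=> j; apply: (@blk_inj i).
by rewrite blk_permE ?blk_stab1 // !perm1.
Qed.
Lemma blk_permM i s t : s \in blk_stab -> t \in blk_stab ->
  blk_perm i (s * t) = (blk_perm i s * blk_perm i t)%g.
Proof.
move=> Hs Ht; apply/permP=> j; apply: (@blk_inj i).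
by rewrite permM !blk_permE ?blk_stabM // permM.
Qed.

Lemma tX_in X k : tX X k \in split_val X (blk_index k).
Proof. by rewrite permE tX_fun_in. Qed.
Lemma tX_index X k i : tX X k \in split_val X i -> blk_index k = i.
Proof. exact: split_disjoint (tX_in X k). Qed.

(* The permutations t_X represent the left cosets of S_c.                     *)
Lemma tX_coset (s : 'S_r) X Y :
  (((tX X) * s * (tX Y)^-1)%g \in blk_stab) = (Y == split_act s X).
Proof.
apply/blk_stabP/eqP => [H | -> k].
  apply/val_inj/ffunP=> i; rewrite ffunE; apply/esym/eqP.
  rewrite eqEcard card_imset ?split_card ?leqnn ?andbT; last exact: perm_inj.
  apply/subsetP=> _ /imsetP[k Xk ->].
  have {H} := H ((tX X)^-1%g k); rewrite !permM permKV => e.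
  have := tX_in Y ((tX Y)^-1%g (s k)); rewrite permKV e.
  by rewrite (@tX_index X _ i) // permKV.
rewrite !permM; apply: (@tX_index (split_act s X)).
by rewrite permKV ffunE imset_f // tX_in.
Qed.
End Blocks.

Section Specht.
Variable p : intpart.
Let rows (i : 'I_(size p)) : nat := nth 0%N p i.
Let Hp : (\sum_i rows i)%N = psize p := erefl.

(* The boxes of the Young diagram of p are numbered row by row by             *)
(* 'I_(psize p), and entry k of the reference tableau is in box k; so         *)
(* blk_index Hp k and blk_pos Hp k are the row and the column of k.  A        *)
(* p-tabloid is the sequence of the sets of entries of its rows.              *)
Definition tabloid : finType := split_of (psize p) rows.

(* MathComp representations act on the right of row vectors: the row vector   *)
(* of T is sent by tabloid_mx s to the row vector of s T.                     *)
Definition tabloid_mx (s : 'S_(psize p)) : 'M[algC]_#|tabloid| :=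
  \matrix_(i, j) (enum_val j == split_act s (enum_val i))%:R.
Fact tabloid_mx_repr : mx_repr [set: 'S_(psize p)] tabloid_mx.
Proof.
split=> [|s t _ _]; apply/matrixP=> i j; rewrite !mxE.
  by rewrite split_act1 (inj_eq enum_val_inj) eq_sym.
rewrite (bigD1 (enum_rank (split_act s (enum_val i)))) //= !mxE enum_rankK.
rewrite eqxx mul1r split_actM big1 ?addr0 // => k nk; rewrite !mxE.
by rewrite -(inj_eq enum_val_inj) enum_rankK in nk; rewrite (negbTE nk) mul0r.
Qed.
Definition tabloid_repr := MxRepresentation tabloid_mx_repr.

Definition col_stab : {set 'S_(psize p)} :=
  [set s : 'S_(psize p) |
    [forall k, blk_pos Hp (s k) == blk_pos Hp k :> nat]].

(* The polytabloid of the reference tableau.                                  *)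
Definition polytabloid : 'rV[algC]_#|tabloid| :=
  \row_j \sum_(s in col_stab)
     (-1) ^+ odd_perm s * (enum_val j == split_act s (split0 Hp))%:R.

(* The Specht module, the span of the translates of this polytabloid, that    *)
(* is, of all polytabloids.                                                   *)
Definition specht_dim : nat := \rank (cyclic_mx tabloid_repr polytabloid).
Definition specht_repr : mx_representation algC [set: 'S_(psize p)] specht_dim :=
  submod_repr (cyclic_mx_module tabloid_repr polytabloid).
End Specht.

Record multipart (r n : nat) :=
  Multipart { mval :> {ffun 'I_n -> intpart};
              mvalP : (\sum_i psize (mval i))%N == r }.
HB.instance Definition _ r n := [isSub for @mval r n].
HB.instance Definition _ r n := [Choice of multipart r n by <:].

Lemma big_distr_dffun (I : finType) (T : I -> finType) (F : forall i, T i -> algC) :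
  \prod_i \sum_(j : T i) F i j =
  \sum_(f : {dffun forall i, T i}) \prod_i F i (f i).
Proof.
rewrite (reindex (@dffun_of_fprod I T)) /=; last first.
  exact/onW_bij/dffun_of_fprod_bij.
pose P_ i := [ffun j => F i j].
transitivity (\sum_(t : fprod T) \prod_(i in I) P_ i (t i)).
  pose E i := \sum_(j in tagged_with T i) untag 0 (P_ i) j.
  transitivity (\prod_i E i); last first.
    rewrite (bigA_distr_big_dep (tagged_with T) (fun i => untag 0 (P_ i))).
    exact/esym/(@big_fprod algC 0 1 *%R +%R I T P_).
  apply: eq_bigr => i _; rewrite /E -(big_tag (fun i => P_ i : T i -> algC) i).
  by apply: eq_bigr => j _; rewrite ffunE.
by apply: eq_bigr => t _; apply: eq_bigr => i _; rewrite !ffunE.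
Qed.

Section WRepr.
Variables (n r : nat) (lam : multipart r n).
Let G := wreath n r.
Let c (i : 'I_n) : nat := psize (lam i).
Let Hr : (\sum_i c i)%N = r := eqP (mvalP lam).

Definition Gc : {set G} := [set g : G | ws g \in blk_stab Hr].

Definition Vbasis : finType := {dffun forall i : 'I_n, 'I_(specht_dim (lam i))}.

(* For g in Gc, the coefficient on e_J = e_(J 0) (x) ... (x) e_(J n-1) of     *)
(* g e_I in V_lam; by the row-vector convention, the coefficient on e_j of    *)
(* s e_i in the Specht module is specht_repr _ s i j.                         *)
Definition Vcoef (g : G) (J I : Vbasis) : algC :=
  (\prod_i \prod_(k in blkset Hr i) rootU_val (wz g k) ^+ i) *
  \prod_i specht_repr (lam i) (blk_perm Hr i (ws g)) (I i) (J i).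

Definition Xset : finType := split_of r c.
Definition tXG (X : Xset) : G := Wreath [ffun=> 1%g] (tX Hr X).

(* Matrices of W_lam in the basis t_X (x) e_I, acting on column vectors:      *)
(* column (X, I) of W_mx g holds the coordinates of g (t_X (x) e_I).          *)
Definition Wbasis : finType := (Xset * Vbasis)%type.
Definition Wcoef (g : G) (YJ XI : Wbasis) : algC :=
  let h := ((tXG YJ.1)^-1 * g * tXG XI.1)%g in
  if h \in Gc then Vcoef h YJ.2 XI.2 else 0.
Definition W_mx (g : G) : 'M[algC]_#|Wbasis| :=
  \matrix_(i, j) Wcoef g (enum_val i) (enum_val j).

Lemma ws1 : ws (1%g : G) = 1%g. Proof. by []. Qed.
Lemma wsM (g h : G) : ws (g * h)%g = (ws h * ws g)%g. Proof. by []. Qed.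
Lemma wsV (g : G) : ws (g^-1)%g = (ws g)^-1%g. Proof. by []. Qed.
Lemma wzM (g h : G) k : wz (g * h)%g k = (wz g k * wz h ((ws g)^-1 k))%g.
Proof. by rewrite ffunE. Qed.

Lemma GcE g : (g \in Gc) = (ws g \in blk_stab Hr). Proof. by rewrite inE. Qed.
Lemma GcM g h : g \in Gc -> h \in Gc -> (g * h)%g \in Gc.
Proof. by rewrite !GcE wsM => Hg Hh; apply: blk_stabM. Qed.

Lemma Vcoef1 J I : Vcoef 1%g J I = (J == I)%:R.
Proof.
rewrite /Vcoef big1 ?mul1r => [|i _]; last first.
  by apply: big1 => k _; rewrite ffunE /= expr1n.
under eq_bigr => i _ do rewrite blk_perm1 repr_mx1 mxE.
have [->|nJ] := eqVneq J I; first by apply: big1 => i _; rewrite eqxx.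
have /existsP[i ni]: [exists i, I i != J i].
  apply: contraR nJ; rewrite negb_exists => /forallP H.
  by apply/eqP/ffunP=> i; apply/esym/eqP; rewrite -[_ == _]negbK H.
by rewrite (bigD1 i) //= (negbTE ni) mul0r.
Qed.

Lemma VcoefM g h K I : g \in Gc -> h \in Gc ->
  Vcoef (g * h)%g K I = \sum_J Vcoef g K J * Vcoef h J I.
Proof.
move=> Hg Hh; have := Hg; have := Hh; rewrite !GcE => sh sg.
rewrite /Vcoef.
under [RHS]eq_bigr => J _ do
  rewrite mulrACA -big_split -[X in _ * X]big_split /=.
rewrite -mulr_sumr; congr (_ * _).
  apply: eq_bigr => i _; under eq_bigr => k _ do rewrite wzM /= exprMn.
  rewrite big_split /=; congr (_ * _).
  rewrite [RHS](reindex_inj (@perm_inj _ (ws g)^-1%g)) /=.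
  apply: eq_bigl => k; rewrite !mem_blkset.
  by have /blk_stabP -> := blk_stabV sg.
rewrite -(big_distr_dffun (fun i j =>
  specht_repr (lam i) (blk_perm Hr i (ws g)) j (K i) *
  specht_repr (lam i) (blk_perm Hr i (ws h)) (I i) j)).
apply: eq_bigr => i _; rewrite wsM blk_permM // repr_mxM ?inE // mxE.
by apply: eq_bigr => j _; rewrite mulrC.
Qed.

Lemma tXG_coset (g : G) X Y :
  (((tXG Y)^-1 * g * tXG X)%g \in Gc) = (Y == split_act (ws g) X).
Proof. by rewrite GcE !wsM wsV /= mulgA tX_coset. Qed.

Fact W_mx_repr : mx_repr [set: G] W_mx.
Proof.
split=> [|g h _ _]; apply/matrixP=> i j; rewrite !mxE.
  rewrite -(inj_eq enum_val_inj) /Wcoef /= tXG_coset ws1 split_act1 mulg1.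
  case: (enum_val i) (enum_val j) => [Y J] [X I] /=.
  rewrite xpair_eqE; by case: eqP => //= ->; rewrite mulVg Vcoef1.
under eq_bigr => l _ do rewrite !mxE.
case: (enum_val i) (enum_val j) => [Z K] [X I] {i j}.
rewrite -(reindex _ (onW_bij _ (enum_val_bij Wbasis)) (P := predT)
  (F := fun YJ => Wcoef g (Z, K) YJ * Wcoef h YJ (X, I))) /=.
rewrite (eq_bigr (fun YJ : Wbasis =>
  Wcoef g (Z, K) (YJ.1, YJ.2) * Wcoef h (YJ.1, YJ.2) (X, I))); last by case.
rewrite -(pair_bigA _ (fun Y J => Wcoef g (Z, K) (Y, J) * Wcoef h (Y, J) (X, I))).
pose Y := split_act (ws h) X.
rewrite (bigD1 Y) //= [X in _ + X]big1 ?addr0 => [|Y' nY]; last first.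
  by apply: big1 => J _; rewrite /Wcoef /= [X in _ * X]ifN ?mulr0 ?tXG_coset.
have hY : ((tXG Y)^-1 * h * tXG X)%g \in Gc by rewrite tXG_coset.
rewrite /Wcoef /= !tXG_coset wsM split_actM -/Y eqxx.
case: ifP => gZ; last by rewrite big1 // => J _; rewrite mul0r.
rewrite -VcoefM //; last by rewrite tXG_coset.
by congr Vcoef; rewrite !mulgA mulgK.
Qed.
(* The G(n,1,r)-module W_lam, with representation rho_lam.                    *)
Definition W_repr : mx_representation algC [set: G] #|Wbasis| :=
  MxRepresentation W_mx_repr.
End WRepr.

Section CyclicStructure.
Variables n r : nat.
Let G := wreath n r.

(* The cycles of s, fixed points included, are given by their supports: the   *)
(* orbits of s.                                                               *)
Definition cycprod (g : G) (A : {set 'I_r}) : algC :=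
  \prod_(k in A) rootU_val (wz g k).

Definition has_cycstruct (zeta : algC) (eta : {ffun 'I_n -> intpart}) (g : G) :=
  forall u : 'I_n,
    perm_eq (eta u)
            [seq #|A| | A : {set 'I_r} <- enum (porbits (ws g)) &
                        cycprod g A == zeta ^+ u].

(* The cycles of g are (L_j + 1 ... L_j + l_j), and z_k = 1 unless k is the   *)
(* first point of a cycle, so that z at that point is the cycle product.      *)
(* The order of the cycles is left free.                                      *)
Definition standard_form (g : G) :=
  exists (s : nat) (l : 'I_s -> nat) (Hl : (\sum_j l j)%N = r),
    [/\ forall j, (0 < l j)%N,
        forall j (k : 'I_(l j)), ws g (blk Hl k) = blk Hl (ordS k)
      & forall j (k : 'I_(l j)), (0 < k)%N -> wz g (blk Hl k) = 1%g].

Definition standard_rep zeta (eta : multipart r n) (g : G) :=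
  has_cycstruct zeta eta g /\ standard_form g.
End CyclicStructure.

Definition part_length n (eta : {ffun 'I_n -> intpart}) : nat :=
  \sum_u size (eta u).

(* ords s i = i + s mod n. *)
Definition ords n (s : nat) : 'I_n -> 'I_n := iter s (@ordS n).

Section MOperator.
Variables (d e r : nat).
Let n := (d * e)%N.
Let G := wreath n r.

Definition eps (g : G) : algC := (\prod_k rootU_val (wz g k)) ^+ d.

Fact eps_repr_subproof j :
  mx_repr [set: G] (fun g => (eps g ^+ j)%:M : 'M[algC]_1).
Proof.
split=> [|g h _ _]; last rewrite -scalar_mxM -exprMn /eps -exprMn.
  by rewrite /eps big1 ?expr1n // => k _; rewrite ffunE.
congr ((_ ^+ d) ^+ j)%:M; under eq_bigr => k _ do rewrite wzM.
rewrite big_split /=; congr (_ * _).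
by rewrite [RHS](reindex_inj (@perm_inj _ (ws g)^-1%g)).
Qed.
(* The linear character eps^j, as a one-dimensional representation.           *)
Definition eps_repr j : mx_representation algC [set: G] 1 :=
  MxRepresentation (eps_repr_subproof j).
Definition eps_char : 'CF([set: G]) := cfRepr (eps_repr 1).

Variable lam : multipart r n.


Definition in_C (chi : 'CF([set: G])) : Prop :=
  exists2 j : nat, chi = eps_char ^+ j &
    mx_rsim (prod_repr (eps_repr j) (W_repr lam)) (W_repr lam).

(* The matrix of M_lam, for b = b_lam.  When lam is invariant under the shift *)
(* of indices by d b, the Specht modules of lam i and lam (i + d b) and their *)
(* bases are the same, and the equality of the positions of two basis vectors *)
(* as natural numbers is their equality.                                      *)
Definition Mcoef (b : nat) (YJ XI : Wbasis lam) : algC :=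
  ((split_val YJ.1 == [ffun u => split_val XI.1 (ords (d * b) u)]) &&
   [forall u, YJ.2 u == XI.2 (ords (d * b) u) :> nat])%:R.
Definition M_mx (b : nat) : 'M[algC]_#|Wbasis lam| :=
  \matrix_(i, j) Mcoef b (enum_val i) (enum_val j).

Definition Delta (b k : nat) (g : G) : algC :=
  \tr (M_mx b ^+ k *m W_repr lam g).
End MOperator.

Definition has_card (T : eqType) (P : T -> Prop) (N : nat) :=
  exists s : seq T, [/\ uniq s, size s = N & forall x, x \in s <-> P x].

(* The multipartition mu = (lam 0, ..., lam (k-1)), padded by empty ones.     *)
Definition head_part n (k : nat) (lam : {ffun 'I_n -> intpart}) :
    {ffun 'I_n -> intpart} :=
  [ffun i : 'I_n => if (i < k)%N then lam i else empty_part].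

(* Main.v *)
Require Import Defs.
From mathcomp Require Import all_boot all_order all_algebra.
From mathcomp Require Import all_fingroup all_solvable all_field all_character.
Set Implicit Arguments.
Unset Strict Implicit.
Unset Printing Implicit Defensive.
Import GRing.Theory Num.Theory.
Local Open Scope ring_scope.

(** Put n = d e and m = d b b', so that n = q m, and let s be the permutation
    part of g.

    The operator M^b' permutes the basis of W_lam by shifting all indices by m
    ([Delta_shift_trace]), so Delta is a sum of matrix coefficients of g.  A
    tuple X of disjoint subsets is a colouring f of the r points by n colours,
    and its coefficients vanish unless the colour drops by m, modulo n, at
    every step of s.  Such a colouring comes back to its initial value after a
    full turn around a cycle, so it can only exist if q divides the length of
    every cycle.

    For a fixed colouring, the sum over the tensors v_0 (x) ... (x) v_(n-1)
    splits into one factor for each residue i mod m.  That factor is a sum over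
    closed paths of length q, hence the trace of a product of q matrices of the
    same Specht module ([cycle_sum], [sum_shift_cycles]), and the product is the
    matrix of s^q acting on the points of colour i.  A cycle of s of length l
    whose colours are i mod m meets that colour class in a single cycle of s^q,
    of length l/q ([cyctype_colour_class]).  This gives
    [shift_trace_colourings].

    An admissible colouring is determined by its values psi(A) at one base
    point of each cycle A, and these are arbitrary ([sum_equivariant]).  If g is
    standard, its scalar on the colouring is the product of the xi_A^psi(A),
    where xi_A is the cycle product.  The Specht characters only depend on psi
    modulo m; the sum of the scalar over the q lifts of a residue i is
    q xi_A^i if xi_A^m = 1 and 0 otherwise ([sum_residue_class]).  Both
    vanishing statements follow, and otherwise Delta is q^(number of cycles)
    times a sum [colour_sum] over the colourings of the cycles by m colours, in
    which a cycle of length l counts as l/q.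

    The character of W_mu at g' is the case m = n, q = 1 of the same
    computation ([cfRepr_cycles]).  The empty components of mu forbid the
    colours from m on ([colour_sum_head]), and a bijection between the cycles of
    g and g' ([cycles_bij]) identifies the two sums.

    It remains to see that lam is periodic of period m.  By hypothesis
    eps^b (x) W_lam is isomorphic to W_lam; comparing the two characters by
    Fourier inversion over the diagonal subgroup gives an identity between
    products of Specht characters of the lam_i and of the lam_(i+db).  An
    isomorphism of Specht modules, even up to multiplicities, forces a dominance
    relation between their shapes ([specht_dominance]).  Hence each lam_i
    dominates lam_(i+db), and going around the cycle of indices gives equalities
    ([eps_invariant_shift]).  Since eps has order e, the group C_lam has e/b
    elements ([card_powers]), which is the relation n = q m. *)

(** * Cyclic shifts of an index set *)

Lemma ordsE n k (i : 'I_n) : ords k i = ((i + k) %% n)%N :> nat.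
Proof.
elim: k => [|k IHk]; first by rewrite addn0 modn_small.
by rewrite /ords iterS -/(ords k i) /= IHk -addn1 modnDml addn1 addnS.
Qed.

Lemma ords_inj n k : injective (@ords n k).
Proof. by elim: k => [|k IHk] i j //= /ordS_inj /IHk. Qed.

Lemma ordsD n k l (i : 'I_n) : ords k (ords l i) = ords (k + l) i.
Proof. by rewrite /ords iterD. Qed.

Lemma ords_mul n k (i : 'I_n) : ords (k * n) i = i.
Proof. by apply: val_inj; rewrite /= ordsE addnC modnMDl modn_small. Qed.

Lemma ords_bij n k : bijective (@ords n k).
Proof. exact/injF_bij/ords_inj. Qed.

Lemma ords_invariant n k (T : Type) (F : 'I_n -> T) :
  (forall i, F (ords k i) = F i) -> forall j i, F (ords (j * k) i) = F i.
Proof. by move=> H; elim=> [//|j IH] i; rewrite mulSn -ordsD H. Qed.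

Lemma ordsnn n (u : 'I_n) : ords n u = u.
Proof. by rewrite -[n in ords n]mul1n ords_mul. Qed.

Lemma ords_mod n k l (i : 'I_n) : k = l %[mod n] -> ords k i = ords l i.
Proof. by move=> E; apply: val_inj; rewrite /= !ordsE -modnDmr E modnDmr. Qed.

(** * Cycles of a permutation *)

Section Orbits.
Variables (T : finType) (s : {perm T}).
Implicit Types (x y : T) (A : {set T}).

Lemma porbit_period x k : ((s ^+ k)%g x == x) = (#|porbit s x| %| k)%N.
Proof.
set l := #|_|; have l0 : (0 < l)%N by apply/card_gt0P; exists x; exact: porbit_id.
have xl : (s ^+ l)%g x = x by rewrite permX iter_porbit.
have fixl j : (s ^+ (l * j))%g x = x.
  elim: j => [|j IHj]; first by rewrite muln0 perm1.
  by rewrite mulnS expgD permM xl.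
rewrite {1}(divn_eq k l) mulnC expgD permM fixl /dvdn.
case E: (k %% l)%N => [|j]; first by rewrite expg0 perm1 eqxx.
have ltj : (j.+1 < l)%N by rewrite -E ltn_pmod.
apply/negbTE; have := uniq_traject_porbit s x; rewrite -/l.
move/(nth_uniq x); rewrite size_traject => /(_ j.+1 0%N ltj l0).
by rewrite !nth_traject // permX /= => ->.
Qed.

Lemma permX_card_porbit x : (s ^+ #|porbit s x|)%g x = x.
Proof. by rewrite permX iter_porbit. Qed.

Lemma permX_eq x j k :
  ((s ^+ j)%g x == (s ^+ k)%g x) = (j == k %[mod #|porbit s x|]).
Proof.
wlog le_jk : j k / (j <= k)%N.
  by move=> W; case/orP: (leq_total j k) => /W // e; rewrite eq_sym e eq_sym.
rewrite -{1}(subnK le_jk) expgD permM (inj_eq perm_inj) eq_sym porbit_period.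
by rewrite [RHS]eq_sym eqn_mod_dvd.
Qed.

Lemma porbitsE A x : A \in porbits s -> x \in A -> A = porbit s x.
Proof. by case/imsetP=> y _ -> yx; apply/eqP; rewrite eq_porbit_mem porbit_sym. Qed.

Lemma mem_porbits x : porbit s x \in porbits s.
Proof. exact: imset_f. Qed.

Lemma porbits_neq0 A : A \in porbits s -> exists x, x \in A.
Proof. by case/imsetP=> x _ ->; exists x; exact: porbit_id. Qed.

Lemma porbit_perm_image x : porbit s (s x) = porbit s x.
Proof. by apply/eqP; rewrite eq_porbit_mem; have := mem_porbit s 1 x; rewrite expg1. Qed.

Lemma porbits_mem_perm A x : A \in porbits s -> (s x \in A) = (x \in A).
Proof.
case/imsetP=> y _ ->; rewrite -!eq_porbit_mem.
by rewrite porbit_perm_image.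
Qed.

Lemma big_porbits (R : Type) (idx : R) (op : Monoid.com_law idx) (F : T -> R) :
  \big[op/idx]_x F x = \big[op/idx]_(A in porbits s) \big[op/idx]_(x in A) F x.
Proof.
rewrite (partition_big (porbit s) (mem (porbits s))) => [|x _] /=; last first.
  exact: mem_porbits.
apply: eq_bigr => A sA; apply: eq_bigl => x.
by apply/eqP/idP => [<-|/(porbitsE sA)//]; apply: porbit_id.
Qed.

Definition cyctype : seq nat := [seq #|A| | A <- enum (porbits s)].

Lemma sumn_cyctype : sumn cyctype = #|T|.
Proof.
rewrite /cyctype sumnE big_map big_enum /= -sum1_card big_porbits.
by apply: eq_bigr => A _; rewrite sum1_card.
Qed.
End Orbits.

Lemma cyctype1 (T : finType) : cyctype (1 : {perm T})%g = nseq #|T| 1%N.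
Proof.
have /all_pred1P E : all (pred1 1%N) (cyctype (1 : {perm T})%g).
  rewrite all_map; apply/allP=> A; rewrite mem_enum => /imsetP[x _ ->] /=.
  by rewrite -dvdn1 -porbit_period expg1 perm1.
by have := sumn_cyctype (1 : {perm T})%g; rewrite E sumn_nseq mul1n => <-.
Qed.

(** The cycles of s as a finite type, so that they can index finite functions. *)
Notation orb s := {A : {set _} | A \in porbits s}.

Lemma big_orb (T : finType) (s : {perm T}) (R : Type) (idx : R)
    (op : Monoid.com_law idx) (F : T -> R) :
  \big[op/idx]_x F x = \big[op/idx]_(A : orb s) \big[op/idx]_(x in val A) F x.
Proof.
rewrite (big_porbits s).
by rewrite (big_sub _ (fun A : {set T} => \big[op/idx]_(x in A) F x)).
Qed.

Lemma card_orb (T : finType) (s : {perm T}) : #|{: orb s}| = #|porbits s|.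
Proof. by rewrite card_sig; apply: eq_card => A; rewrite inE. Qed.

Lemma orbit_bases (T : finType) (s : {perm T}) :
  exists x : orb s -> T, forall A, x A \in val A.
Proof.
have ex (A : orb s) : exists k, k \in val A by apply: porbits_neq0 (valP A).
by exists (fun A => xchoose (ex A)) => A; apply: xchooseP (ex A).
Qed.

(** Equal multisets of values are matched by a bijection of the indices.
    Removing one matched pair at a time works even when values are repeated. *)
Lemma perm_eq_bij (T1 T2 R : eqType) (y0 : T2) (F1 : T1 -> R) (F2 : T2 -> R) s1 s2 :
  uniq s1 -> uniq s2 -> perm_eq (map F1 s1) (map F2 s2) ->
  exists h : T1 -> T2, [/\ {in s1, forall x, h x \in s2},
    {in s1 &, injective h} & {in s1, forall x, F2 (h x) = F1 x}].
Proof.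
elim: s1 s2 => [|x s1 IH] s2 /=; first by exists (fun=> y0).
case/andP=> xs1 us1 us2 E.
have /mapP[y ys2 Fy] : F1 x \in map F2 s2 by rewrite -(perm_mem E) mem_head.
have {E} : perm_eq (map F1 s1) (map F2 (rem y s2)).
  rewrite -(perm_cons (F1 x)) (perm_trans E) // Fy -map_cons perm_map //.
  exact: perm_to_rem.
case/(IH _ us1 (rem_uniq y us2)) => h [h_in h_inj hF].
have hy z : z \in s1 -> h z != y /\ h z \in s2.
  by move/h_in; rewrite mem_rem_uniq // !inE => /andP.
exists (fun z => if z == x then y else h z); split=> [z|z1 z2|z]; rewrite !inE.
- by case: eqP => // _ /= /hy[].
- case: (z1 =P x) (z2 =P x) => [->|_] [->|_] //=.
  + by move=> _ /hy[/eqP n _] e; rewrite e in n.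
  + by move=> /hy[/eqP n _] _ e; rewrite e in n.
  exact: h_inj.
by case: eqP => [-> _|_ /= /hF].
Qed.

(** Match the cycles of s and t by length, choose a base point in each cycle, and
    send s^a (base) to t^a (matching base).  The exponent a is only defined modulo
    the length of the cycle, which is the same on both sides. *)
Lemma cyctype_conj (T : finType) (s t : {perm T}) :
  perm_eq (cyctype s) (cyctype t) -> exists u : {perm T}, t = (s ^ u)%g.
Proof.
case/(@perm_eq_bij _ _ _ set0 _ _ _ _ (enum_uniq _) (enum_uniq _)) => h [h_in h_inj hc].
have {}h_in x : h (porbit s x) \in porbits t.
  by rewrite -mem_enum h_in ?mem_enum ?mem_porbits.
have {}hc x : #|h (porbit s x)| = #|porbit s x| by rewrite hc ?mem_enum ?mem_porbits.
pose rep x := odflt x [pick y in porbit s x].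
have rep_in x : rep x \in porbit s x.
  by rewrite /rep; case: pickP => // /(_ x); rewrite porbit_id.
have rep_eq x y : porbit s x = porbit s y -> rep x = rep y.
  rewrite /rep => ->; case: pickP => // /(_ y); by rewrite porbit_id.
pose rep' x := odflt x [pick y in h (porbit s x)].
have rep'_in x : rep' x \in h (porbit s x).
  rewrite /rep'; case: pickP => //.
  by have [y yh /(_ y)] := porbits_neq0 (h_in x); rewrite yh.
have rep'_eq x y : porbit s x = porbit s y -> rep' x = rep' y.
  rewrite /rep' => ->; case: pickP => // H.
  by have [z zh] := porbits_neq0 (h_in y); move: (H z); rewrite zh.
have ex x : exists a, x == (s ^+ a)%g (rep x).
  have : x \in porbit s (rep x) by rewrite porbit_sym rep_in.
  by case/porbitP=> a /eqP; exists a.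
pose a x := xchoose (ex x).
have aP x : x = (s ^+ a x)%g (rep x) by apply/eqP/(xchooseP (ex x)).
pose f x := (t ^+ a x)%g (rep' x).
have hE x : h (porbit s x) = porbit t (rep' x) by apply: porbitsE.
have crep x : porbit s (rep x) = porbit s x.
  by apply/eqP; rewrite eq_porbit_mem rep_in.
have f_inj : injective f.
  move=> x y fxy; have fx z : f z \in h (porbit s z) by rewrite hE mem_porbit.
  have oxy : porbit s x = porbit s y.
    apply: h_inj; rewrite ?mem_enum ?mem_porbits //.
    by rewrite (porbitsE (h_in x) (fx x)) (porbitsE (h_in y) (fx y)) fxy.
  rewrite (aP x) (aP y) (rep_eq _ _ oxy); apply/eqP.
  rewrite permX_eq crep -hc hE -permX_eq -/(f y).
  by rewrite -(rep'_eq _ _ oxy) -fxy.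
exists (perm f_inj); apply/permP=> y; rewrite -[y](permKV (perm f_inj)).
move: (_ y) => {}y; rewrite permJ !permE /f.
have oxy : porbit s y = porbit s (s y) by rewrite porbit_perm_image.
rewrite -(rep'_eq _ _ oxy) -permM -expgSr; apply/eqP.
rewrite permX_eq -hE hc -crep -permX_eq (rep_eq _ _ oxy) -(aP (s y)).
by rewrite -(rep_eq _ _ oxy) expgSr permM -aP.
Qed.

(** * Specht characters as functions of the cycle type *)

(** Recording the multiset of cycle lengths instead of a permutation allows the
    comparison of Specht modules whose degrees are equal but not convertible.  The
    value 0 for multisets that are not cycle types makes every condition on the
    sizes of colour classes automatic. *)
Definition specht_char (p : intpart) (L : seq nat) : algC :=
  if [pick s : 'S_(psize p) | perm_eq (cyctype s) L] is Some s
  then \tr (specht_repr p s) else 0.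

Lemma specht_charE p s L : perm_eq (cyctype s) L -> specht_char p L = \tr (specht_repr p s).
Proof.
rewrite /specht_char => Hs; case: pickP => [t Ht|/(_ s)]; last by rewrite Hs.
have [|u ->] := @cyctype_conj _ s t; first by rewrite (perm_trans Hs) // perm_sym.
rewrite conjgE !repr_mxM ?inE // mxtrace_mulC -mulmxA -repr_mxM ?inE //.
by rewrite mulgV repr_mx1 mulmx1.
Qed.

Lemma eq_specht_char p L L' : perm_eq L L' -> specht_char p L = specht_char p L'.
Proof.
move=> E; rewrite /specht_char; congr (if _ is Some _ then _ else _).
by apply: eq_pick => s; rewrite (perm_sym _ L) (perm_sym _ L') (permPl E).
Qed.

Lemma specht_char_neq0 p L : specht_char p L != 0 -> sumn L = psize p.
Proof.
rewrite /specht_char; case: pickP => [s E _|]; last by rewrite eqxx.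
by rewrite -(perm_sumn E) sumn_cyctype card_ord.
Qed.

(** * Specht modules of different shapes *)

(** K / a is a projector, so the trace of K is a times the rank of K. *)
Lemma mxtrace_quasi_idem_neq0 d (K : 'M[algC]_d) (a : algC) :
  a != 0 -> K *m K = a *: K -> K != 0 -> \tr K != 0.
Proof.
move=> a0 KK; rewrite -mxrank_eq0 => rK0.
have fR : row_base K *m col_base K = a%:M.
  have E : (col_base K *m (row_base K *m col_base K)) *m row_base K =
           (col_base K *m a%:M) *m row_base K.
    rewrite mulmxA mulmx_base -mulmxA mulmx_base KK.
    by rewrite -mulmxA mul_scalar_mx -scalemxAr mulmx_base.
  apply: (row_full_inj (col_base_full K)); exact: (row_free_inj (row_base_free K)) E.
rewrite -{1}(mulmx_base K) mxtrace_mulC fR mxtrace_scalar.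
by rewrite -mulr_natr mulf_neq0 // pnatr_eq0.
Qed.

Section SignedSum.
Variables (N : nat) (pos : 'I_N -> nat).

(** When pos is the column of an entry in a tableau, this is the column stabilizer.
    The numbering pos is kept arbitrary because the column stabilizer of one shape
    has to act on the tabloids of another. *)
Definition fibre_stab : {set 'S_N} := [set s : 'S_N | [forall k, pos (s k) == pos k]].

Lemma fibre_stabP (s : 'S_N) : reflect (forall k, pos (s k) = pos k) (s \in fibre_stab).
Proof. by rewrite inE; apply: (iffP forallP) => H k; apply/eqP. Qed.

Lemma fibre_stab1 : 1%g \in fibre_stab.
Proof. by apply/fibre_stabP=> k; rewrite perm1. Qed.

Lemma fibre_stabMl s t : s \in fibre_stab -> ((s * t)%g \in fibre_stab) = (t \in fibre_stab).
Proof.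
move=> /fibre_stabP Hs; apply/fibre_stabP/fibre_stabP => H k; last by rewrite permM H Hs.
by have := H ((s^-1)%g k); rewrite permM permKV => ->; rewrite -[in RHS](permKV s k) Hs.
Qed.

Definition antisymm d (rG : mx_representation algC [set: 'S_N] d) : 'M_d :=
  \sum_(s in fibre_stab) (-1) ^+ odd_perm s *: rG s.

(** The signed sum of a group absorbs the elements of the group up to their sign. *)
Lemma antisymmM d (rG : mx_representation algC [set: 'S_N] d) :
  antisymm rG *m antisymm rG = #|fibre_stab|%:R *: antisymm rG.
Proof.
rewrite {1}/antisymm mulmx_suml -sumr_const scaler_suml; apply: eq_bigr => s Cs.
rewrite scale1r {2}/antisymm (reindex_inj (mulgI s)) /=.
rewrite /antisymm mulmx_sumr; apply: eq_big => [t|t _]; first by rewrite fibre_stabMl.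
rewrite -scalemxAl -scalemxAr scalerA repr_mxM ?inE //.
by rewrite odd_permM signr_addb.
Qed.

Lemma card_fibre_stab_neq0 : #|fibre_stab|%:R != 0 :> algC.
Proof. by rewrite pnatr_eq0 -lt0n; apply/card_gt0P; exists 1%g; exact: fibre_stab1. Qed.
End SignedSum.

Lemma split_act_tperm n r (c : 'I_n -> nat) (X : split_of r c) i a b :
  a \in split_val X i -> b \in split_val X i -> split_act (tperm a b) X = X.
Proof.
move=> Xa Xb; apply/val_inj/ffunP=> u; rewrite ffunE; apply/eqP.
rewrite eqEcard card_imset ?leqnn ?andbT; last exact: perm_inj.
apply/subsetP=> _ /imsetP[k Xk ->]; case: tpermP => [ka|kb|//].
  by rewrite ka in Xk; rewrite (split_disjoint Xk Xa).
by rewrite kb in Xk; rewrite (split_disjoint Xk Xb).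
Qed.

Section Specht.
Variable p : intpart.
Let rows (i : 'I_(size p)) : nat := nth 0%N p i.
Let Hp : (\sum_i rows i)%N = psize p := erefl.

Lemma antisymm_tabloidE pos i j : antisymm pos (tabloid_repr p) i j =
  \sum_(s in fibre_stab pos)
     (-1) ^+ odd_perm s * (enum_val j == split_act s (enum_val i))%:R.
Proof. by rewrite /antisymm summxE; apply: eq_bigr => s _; rewrite !mxE. Qed.

(** If a and b lie in the same fibre of pos and in the same row of X, then the
    transposition (a b) fixes X, so the terms of s and (a b) s cancel. *)
Lemma antisymm_tabloid_eq0 pos :
  (forall X : tabloid p, exists i a b, [/\ a != b, pos a = pos b,
     a \in split_val X i & b \in split_val X i]) ->
  antisymm pos (tabloid_repr p) = 0.
Proof.
move=> H; apply/matrixP=> i j; rewrite antisymm_tabloidE mxE.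
have [u [a [b [nab pab Xa Xb]]]] := H (enum_val i).
have Ct : tperm a b \in fibre_stab pos.
  by apply/fibre_stabP=> k; case: tpermP => // ->.
apply/eqP; rewrite -[_ == 0](mulrn_eq0 _ 2) mulr2n addr_eq0; apply/eqP.
rewrite [in RHS](reindex_inj (mulgI (tperm a b))) /= -sumrN.
apply: eq_big => [s|s _]; first by rewrite fibre_stabMl.
rewrite split_actM (split_act_tperm Xa Xb) odd_permM odd_tperm nab /=.
by rewrite signrN mulNr opprK.
Qed.

(** The Specht module is a submodule of the tabloid module. *)
Lemma val_submod_antisymm pos k (W : 'M_(k, specht_dim p)) :
  val_submod (W *m antisymm pos (specht_repr p)) =
  val_submod W *m antisymm pos (tabloid_repr p).
Proof.
rewrite /antisymm !mulmx_sumr linear_sum; apply: eq_bigr => s _ /=.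
by rewrite -!scalemxAr linearZ /= val_submodJ ?inE.
Qed.

Lemma antisymm_specht_eq0 pos :
  antisymm pos (tabloid_repr p) = 0 -> antisymm pos (specht_repr p) = 0.
Proof.
move=> K0; apply: (can_inj (val_submodK (U := cyclic_mx (tabloid_repr p) (polytabloid p)))).
by rewrite -[antisymm _ (specht_repr p)]mul1mx val_submod_antisymm K0 mulmx0 linear0.
Qed.

Definition box_col (k : 'I_(psize p)) : nat := blk_pos Hp k.
Definition box_row (k : 'I_(psize p)) : nat := blk_index Hp k.

Lemma polytabloidE :
  polytabloid p = row (enum_rank (split0 Hp)) (antisymm box_col (tabloid_repr p)).
Proof. by apply/rowP=> j; rewrite !mxE antisymm_tabloidE enum_rankK. Qed.

Lemma polytabloid_neq0 : polytabloid p != 0.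
Proof.
apply/eqP=> /rowP/(_ (enum_rank (split0 Hp)))/eqP; rewrite polytabloidE !mxE.
rewrite antisymm_tabloidE !enum_rankK (bigD1 1%g) ?fibre_stab1 //=.
rewrite split_act1 eqxx odd_perm1 mulr1 big1 ?addr0 ?oner_eq0 // => s.
case/andP=> /fibre_stabP Cs ns; case: eqP => [E|_]; last by rewrite mulr0.
case/eqP: ns; apply/permP=> k; rewrite perm1; apply: (@blk_eq _ _ _ Hp); last exact: Cs.
have : s k \in split_val (split_act s (split0 Hp)) (blk_index Hp k).
  by rewrite ffunE imset_f // ffunE mem_blkset.
by rewrite -E ffunE mem_blkset => /eqP.
Qed.

(** The polytabloid e is the signed column sum of a tabloid, so it is an eigenvector
    of the signed column sum, with the order of the column stabilizer as eigenvalue. *)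
Lemma antisymm_specht_neq0 : antisymm box_col (specht_repr p) != 0.
Proof.
apply/eqP=> K0; pose U := cyclic_mx (tabloid_repr p) (polytabloid p).
have : val_submod (in_submod U (polytabloid p) *m antisymm box_col (specht_repr p)) = 0.
  by rewrite K0 mulmx0 linear0.
rewrite val_submod_antisymm in_submodK ?cyclic_mx_id //.
rewrite {1}polytabloidE -row_mul antisymmM linearZ /= -polytabloidE.
by move/eqP; rewrite scaler_eq0 (negbTE (card_fibre_stab_neq0 _)) (negbTE polytabloid_neq0).
Qed.

Lemma tr_antisymm_specht_neq0 : \tr (antisymm box_col (specht_repr p)) != 0.
Proof.
by apply: mxtrace_quasi_idem_neq0 (antisymmM _ _) antisymm_specht_neq0; apply: card_fibre_stab_neq0.
Qed.

Lemma specht_dim_gt0 : (0 < specht_dim p)%N.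
Proof.
rewrite lt0n; apply: contraNneq antisymm_specht_neq0 => E.
by apply/eqP/matrixP=> -[i lti]; have := lti; rewrite {1}E.
Qed.

Lemma card_box_row i : #|[set k | box_row k == i]| = nth 0%N p i.
Proof.
have [lti|lei] := ltnP i (size p); last first.
  rewrite nth_default //; apply/eqP; rewrite cards_eq0; apply/eqP/setP=> k.
  by rewrite !inE ltn_eqF // (leq_trans (ltn_ord (blk_index Hp k))).
rewrite -[RHS]/(rows (Ordinal lti)) -(split_card (split0 Hp)).
by apply: eq_card => k; rewrite inE ffunE mem_blkset -val_eqE.
Qed.

(** Row lengths are decreasing, so there is no gap in a column. *)
Lemma box_above k i : (i < box_row k)%N ->
  exists2 k0, box_col k0 = box_col k & box_row k0 = i.
Proof.
move=> ltik; have lti : (i < size p)%N := ltn_trans ltik (ltn_ord _).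
have ltj : (box_col k < rows (Ordinal lti))%N.
  apply: leq_trans (ltn_ord (blk_pos Hp k)) _; rewrite /rows /=.
  case/andP: (pvalP p) => srt _.
  have geq_trans : transitive geq by move=> y x z /= yx zy; apply: leq_trans zy yx.
  have := sorted_leq_nth geq_trans leqnn 0%N srt.
  by move/(_ _ _ lti (ltn_ord (blk_index Hp k)) (ltnW ltik)).
exists (blk Hp (Ordinal ltj)); first by rewrite /box_col blk_posK.
by rewrite /box_row blk_indexK.
Qed.
End Specht.

(** Compare column by column.  If a column of the diagram reaches row m, then its
    first m rows are full, and the other side has at most one point in each of these
    rows.  Otherwise the whole column lies in the first m rows. *)
Lemma card_dominance (T T' : finType) (row col : T -> nat) (row' col' : T' -> nat) :
  (forall k i, (i < row k)%N -> exists2 k0, col k0 = col k & row k0 = i) ->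
  (forall a b, row' a = row' b -> col' a = col' b -> a = b) ->
  (forall c, #|[set k | col' k == c]| = #|[set k | col k == c]|) ->
  forall m, (#|[set k | row' k < m]| <= #|[set k | row k < m]|)%N.
Proof.
move=> up inj eqc m; pose B := (\max_k col k + \max_k col' k).+1.
have cB k : (col k < B)%N by rewrite ltnS (leq_trans _ (leq_addr _ _)) // leq_bigmax.
have c'B k : (col' k < B)%N by rewrite ltnS (leq_trans _ (leq_addl _ _)) // leq_bigmax.
rewrite -!sum1_card (partition_big (fun k => Ordinal (c'B k)) predT) //=.
rewrite [X in (_ <= X)%N](partition_big (fun k => Ordinal (cB k)) predT) //=.
apply: leq_sum => c _; rewrite !sum1dep_card.
set A' := [set x | _ & _]; set A := [set x | _ & _].
have row'_inj : {in enum A' &, injective row'}.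
  move=> a b; rewrite !mem_enum !inE -!val_eqE /= => /andP[_ /eqP ac] /andP[_ /eqP bc] e.
  by apply: inj => //; rewrite ac bc.
have [/existsP[k /andP[/eqP kc mk]]|] := boolP [exists k, (col k == c) && (m <= row k)%N].
  apply: (@leq_trans m).
    rewrite cardE -(size_map row') -[X in (_ <= X)%N](size_iota 0); apply: uniq_leq_size.
      by rewrite map_inj_in_uniq ?enum_uniq.
    by move=> i /mapP[x]; rewrite mem_enum mem_iota !inE => /andP[xm _] ->.
  rewrite cardE -(size_map row) -[X in (X <= _)%N](size_iota 0).
  apply: uniq_leq_size; first exact: iota_uniq.
  move=> i; rewrite mem_iota /= => im.
  have [k0 ck0 rk0] := up k i (leq_trans im mk).
  by apply/mapP; exists k0; rewrite ?rk0 // mem_enum !inE rk0 im -val_eqE /= ck0 kc eqxx.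
rewrite negb_exists => /forallP H.
apply: leq_trans (_ : #|[set k | col k == c]| <= _)%N.
  rewrite -eqc subset_leq_card //; apply/subsetP=> x.
  by rewrite !inE -val_eqE /= => /andP[].
apply: subset_leq_card; apply/subsetP=> x; rewrite !inE => xc.
by move: (H x); rewrite xc -ltnNge -val_eqE /= xc andbT.
Qed.

Lemma card_rows (T : finType) (row : T -> nat) (p : seq nat) :
  (forall i, #|[set k | row k == i]| = nth 0%N p i) ->
  forall m, #|[set k | row k < m]%N| = (\sum_(i < m) nth 0 p i)%N.
Proof.
move=> H; elim=> [|m IH]; first by rewrite big_ord0; apply: eq_card0 => k; rewrite inE.
rewrite big_ord_recr /= -IH -H -cardsUI [X in (_ + X)%N]eq_card0 ?addn0.
  by apply: eq_card => k; rewrite !inE ltnS leq_eqVlt orbC.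
by move=> k; rewrite !inE; case: ltngtP.
Qed.

Lemma sum_fibre_stab_cast N N' (E : N' = N) (pos : 'I_N -> nat) (F : seq nat -> algC) :
  \sum_(s in fibre_stab pos) (-1) ^+ odd_perm s * F (cyctype s) =
  \sum_(s in fibre_stab (fun k => pos (cast_ord E k))) (-1) ^+ odd_perm s * F (cyctype s).
Proof.
case: _ / E pos => pos; apply: eq_bigl => s; rewrite !inE.
by apply: eq_forallb => k; rewrite !cast_ord_id.
Qed.

Lemma mxtrace_antisymm N pos d (rG : mx_representation algC [set: 'S_N] d) :
  \tr (antisymm pos rG) = \sum_(s in fibre_stab pos) (-1) ^+ odd_perm s * \tr (rG s).
Proof.
by rewrite /antisymm linear_sum; apply: eq_bigr => s _; rewrite linearZ.
Qed.

Definition dominates (p p' : intpart) :=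
  forall m, (\sum_(i < m) nth 0 p' i <= \sum_(i < m) nth 0 p i)%N.

(** The antisymmetrizer of the columns of p acts on the Specht module of p with
    nonzero trace.  The proportionality transfers this to p', hence the
    antisymmetrizer does not kill all p'-tabloids.  A surviving tabloid has at most
    one entry of each column of p in each of its rows, and counting the entries of
    its first m rows gives the inequality. *)
Lemma specht_dominance (p p' : intpart) (D D' : algC) :
  psize p' = psize p -> D != 0 ->
  (forall s : 'S_(psize p), \tr (specht_repr p s) * D = specht_char p' (cyctype s) * D') ->
  dominates p p'.
Proof.
move=> E D0 H; pose col' k := box_col (cast_ord E k).
have : antisymm col' (tabloid_repr p') != 0.
  apply: contraNneq (tr_antisymm_specht_neq0 p) => /antisymm_specht_eq0 K0.
  suff : \tr (antisymm (@box_col p) (specht_repr p)) * D = 0.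
    by move/eqP; rewrite mulf_eq0 (negbTE D0) orbF.
  have trK0 : \tr (antisymm col' (specht_repr p')) = 0 by rewrite K0 linear0.
  rewrite mxtrace_antisymm mulr_suml; under eq_bigr => s _ do rewrite -mulrA H mulrA.
  (* The column stabilizer of p now acts on the entries of the p'-tabloids. *)
  rewrite -mulr_suml (sum_fibre_stab_cast E).
  transitivity (\tr (antisymm col' (specht_repr p')) * D'); last by rewrite trK0 mul0r.
  rewrite mxtrace_antisymm; congr (_ * _); apply: eq_bigr => s _.
  by rewrite (specht_charE (perm_refl _)).
have [/existsP[X HX] _|] := boolP [exists X : tabloid p', [forall i, forall a, forall b,
  [&& a \in split_val X i, b \in split_val X i & col' a == col' b] ==> (a == b)]].
  have rowX k : exists i, k \in split_val X i := split_cover X k.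
  pose row' k : nat := xchoose (rowX k).
  have row'P (i : 'I_(size p')) k : (row' k == i :> nat) = (k \in split_val X i).
    apply/eqP/idP=> [/val_inj <-|]; first exact: xchooseP (rowX k).
    by move=> Xk; congr nat_of_ord; apply: split_disjoint (xchooseP (rowX k)) Xk.
  have row'_card i : #|[set k | row' k == i]| = nth 0%N p' i.
    have [lti|lei] := ltnP i (size p').
      by rewrite -(split_card X (Ordinal lti)); apply: eq_card => k; rewrite inE -row'P.
    rewrite nth_default //; apply/eqP; rewrite cards_eq0; apply/eqP/setP=> k.
    by rewrite !inE ltn_eqF // (leq_trans (ltn_ord _)).
  move=> m; rewrite -(card_rows row'_card) -(card_rows (@card_box_row p)).
  apply: (@card_dominance _ _ _ (@box_col p) _ col') => [||c].
  - exact: box_above.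
  - move=> a b eab cab; move/forallP/(_ (xchoose (rowX b)))/forallP/(_ a)/forallP/(_ b): HX.
    by rewrite -!row'P eab cab !eqxx => /eqP.
  rewrite -(card_imset _ (@cast_ord_inj _ _ E)); apply: eq_card => k.
  rewrite !inE; apply/imsetP/idP => [[l + ->]|kc]; first by rewrite inE.
  by exists (cast_ord (esym E) k); rewrite ?inE /col' cast_ordKV.
rewrite negb_exists => /forallP H' /eqP[]; apply: antisymm_tabloid_eq0 => X.
have := H' X; rewrite negb_forall => /existsP[i]; rewrite negb_forall => /existsP[a].
rewrite negb_forall => /existsP[b]; rewrite negb_imply => /andP[/and3P[Xa Xb /eqP cab] nab].
by exists i, a, b.
Qed.

Lemma dominates_trans : forall p q r, dominates p q -> dominates q r -> dominates p r.
Proof. by move=> p q r pq qr m; apply: leq_trans (qr m) (pq m). Qed.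

Lemma dominates_anti p q : dominates p q -> dominates q p -> p = q.
Proof.
move=> pq qp.
have E m : (\sum_(i < m) nth 0 p i = \sum_(i < m) nth 0 q i)%N.
  by apply/eqP; rewrite eqn_leq pq qp.
have En i : nth 0%N p i = nth 0%N q i.
  by have := E i.+1; rewrite !big_ord_recr /= E => /addnI.
have sz (a b : intpart) : (forall i, nth 0%N a i = nth 0%N b i) -> (size b <= size a)%N.
  move=> Eab; rewrite leqNgt; apply/negP=> lt_ab; case/andP: (pvalP b) => _ /negP[].
  by rewrite -(nth_default 0%N (leqnn (size a))) Eab mem_nth.
apply/val_inj/(@eq_from_nth _ 0%N) => [|i _]; last exact: En.
by apply/eqP; rewrite eqn_leq !sz.
Qed.

(** This is the dimension of the Specht module. *)
Lemma specht_char1_neq0 (p : intpart) : specht_char p (nseq (psize p) 1%N) != 0.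
Proof.
rewrite (@specht_charE _ 1%g); first by rewrite repr_mx1 mxtrace1 pnatr_eq0 -lt0n specht_dim_gt0.
by rewrite cyctype1 card_ord.
Qed.

(** The Specht module of the empty partition is the line of its only tabloid. *)
Lemma specht_char_empty L : specht_char empty_part L = (L == [::])%:R.
Proof.
have no (k : 'I_(psize empty_part)) : False.
  by case: k => k; rewrite /psize big_ord0.
have [->|nL] := eqVneq L [::]; last first.
  apply/eqP; apply: contraNT nL; rewrite /specht_char; case: pickP; rewrite ?eqxx // => s E _.
  rewrite -size_eq0 -(perm_size E) size_map -cardE cards_eq0; apply/eqP/setP=> A.
  rewrite inE; apply/negP=> /porbits_neq0[k _]; case: (no k).
have C1 (s : 'S_(psize empty_part)) : perm_eq (cyctype s) [::].
  suff -> : cyctype s = [::] by [].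
  apply/nilP; rewrite /nilp size_map -cardE cards_eq0; apply/eqP/setP=> A.
  by rewrite inE; apply/negP=> /porbits_neq0[k _]; case: (no k).
rewrite (specht_charE (C1 1%g)) repr_mx1 mxtrace1.
suff -> : specht_dim empty_part = 1%N by [].
apply/eqP; rewrite eqn_leq specht_dim_gt0 andbT (leq_trans (rank_leq_col _)) //.
apply/card_le1P=> /= X _ Y; rewrite !inE; apply/esym/eqP/val_inj/ffunP; by case.
Qed.

(** * Traces as sums over closed paths *)

Section PathSums.
Variable (D : nat).
Implicit Types (B : nat -> 'M[algC]_D).

Fixpoint chain_mx B k : 'M_D := if k is k'.+1 then B k' *m chain_mx B k' else 1%:M.

Lemma sum_ffun_recr k (T : finType) (F : {ffun 'I_k.+1 -> T} -> algC) :
  \sum_K F K = \sum_(K : {ffun 'I_k -> T}) \sum_x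
    F [ffun i => if unlift ord_max i is Some j then K j else x].
Proof.
pose ext (Kx : {ffun 'I_k -> T} * T) : {ffun 'I_k.+1 -> T} :=
  [ffun i => if unlift ord_max i is Some j then Kx.1 j else Kx.2].
pose res (K : {ffun 'I_k.+1 -> T}) := ([ffun j => K (lift ord_max j)], K ord_max).
rewrite pair_bigA (reindex ext) //=; apply: onW_bij; exists res => [[K x]|K].
  rewrite /res /ext /= ffunE unlift_none; congr (_, _).
  by apply/ffunP=> j; rewrite !ffunE liftK.
apply/ffunP=> i; rewrite ffunE; case: unliftP => [j ->|->] //=.
by rewrite ffunE.
Qed.

(** The weight w of the two endpoints is arbitrary, so that the last edge of the
    path can be absorbed into it in the induction. *)
Lemma path_sum B k (w : 'I_D -> 'I_D -> algC) :
  \sum_(K : {ffun 'I_k.+1 -> 'I_D}) w (K ord0) (K ord_max) *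
     \prod_(a < k) B a (K (lift ord0 a)) (K (widen_ord (leqnSn k) a)) =
  \sum_x \sum_y w y x * chain_mx B k x y.
Proof.
elim: k w => [|k IH] w.
  rewrite sum_ffun_recr (big_pred1 [ffun i : 'I_0 => False_rect _ (notF (ltn_ord i))]) /=.
    apply: eq_bigr => x _; rewrite big_ord0 mulr1 !ffunE.
    have -> : ord0 = ord_max :> 'I_1 by apply: val_inj.
    rewrite unlift_none (bigD1 x) //= mxE eqxx mulr1 big1 ?addr0 // => y.
    by rewrite mxE eq_sym => /negbTE->; rewrite mulr0.
  by move=> K; apply/esym/eqP/ffunP=> -[].
rewrite sum_ffun_recr.
transitivity (\sum_(K : {ffun 'I_k.+1 -> 'I_D})
   (\sum_x w (K ord0) x * B k x (K ord_max)) *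
   \prod_(a < k) B a (K (lift ord0 a)) (K (widen_ord (leqnSn k) a))).
  apply: eq_bigr => K _; rewrite mulr_suml; apply: eq_bigr => x _.
  rewrite big_ord_recr /= !ffunE.
  have U0 : unlift ord_max (ord0 : 'I_k.+2) = Some ord0.
    by have -> : ord0 = lift ord_max ord0 :> 'I_k.+2 by [apply: val_inj]; rewrite liftK.
  have Em : widen_ord (leqnSn k.+1) ord_max = lift ord_max ord_max :> 'I_k.+2.
    by apply: val_inj; rewrite /= /bump ltnn.
  have Ex : lift ord0 ord_max = ord_max :> 'I_k.+2 by apply: val_inj.
  rewrite U0 Em Ex !liftK unlift_none -mulrA; congr (_ * _).
  rewrite mulrC; congr (_ * _); apply: eq_bigr => a _; rewrite !ffunE.
  have -> : lift ord0 (widen_ord (leqnSn k) a) = lift ord_max (lift ord0 a) :> 'I_k.+2.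
    by apply: val_inj; rewrite /= /bump /= !add1n leqNgt ltnS ltn_ord.
  have -> : widen_ord (leqnSn k.+1) (widen_ord (leqnSn k) a) =
            lift ord_max (widen_ord (leqnSn k) a) :> 'I_k.+2.
    by apply: val_inj; rewrite /= /bump leqNgt (leq_trans (ltn_ord a) (leqnSn k)).
  by rewrite !liftK.
rewrite (IH (fun y z => \sum_x w y x * B k x z)).
under eq_bigr => x _ do under eq_bigr => y _ do rewrite mulr_suml.
under eq_bigr => x _ do rewrite exchange_big /=.
rewrite exchange_big /=; apply: eq_bigr => x _; rewrite exchange_big /=.
apply: eq_bigr => y _; rewrite mxE mulr_sumr.
by apply: eq_bigr => z _; rewrite mulrA.
Qed.

(** Closing up a path amounts to weighting its endpoints by one more matrix. *)
Lemma cycle_sum B q : (0 < q)%N ->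
  \sum_(K : {ffun 'I_q -> 'I_D}) \prod_(a < q) B a (K (ordS a)) (K a) =
  \tr (chain_mx B q).
Proof.
case: q => // k _; transitivity (\sum_(K : {ffun 'I_k.+1 -> 'I_D})
   B k (K ord0) (K ord_max) *
   \prod_(a < k) B a (K (lift ord0 a)) (K (widen_ord (leqnSn k) a))).
  apply: eq_bigr => K _; rewrite big_ord_recr /= mulrC; congr (_ * _).
    by congr (B k (K _) _); apply: val_inj; rewrite /= modnn.
  apply: eq_bigr => a _; congr (B a (K _) _); apply: val_inj => /=.
  by rewrite modn_small // ltnS.
rewrite path_sum exchange_big /=; apply: eq_bigr => y _; rewrite mxE.
by apply: eq_bigr.
Qed.
End PathSums.

Section ShiftFactor.
Variables (n m q : nat).
Hypotheses (m0 : (0 < m)%N) (q0 : (0 < q)%N) (nE : n = (q * m)%N).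

Lemma leq_modulus : (m <= n)%N. Proof. by rewrite nE leq_pmull. Qed.

Definition low_ord (i : 'I_m) : 'I_n := widen_ord leq_modulus i.
Definition ord_res (u : 'I_n) : 'I_m := Ordinal (ltn_pmod u m0).
Fact ord_quo_subproof (u : 'I_n) : (u %/ m < q)%N.
Proof. by rewrite ltn_divLR // -nE. Qed.

Definition ord_quo (u : 'I_n) : 'I_q := Ordinal (ord_quo_subproof u).

Lemma ords_low_ord a (i : 'I_m) : (a < q)%N -> ords (a * m) (low_ord i) = (a * m + i)%N :> nat.
Proof.
move=> aq; rewrite ordsE addnC modn_small //= [leqRHS]nE (@leq_trans (a.+1 * m)) ?leq_mul //.
by rewrite mulSn addnC ltn_add2r.
Qed.

Lemma ord_resE a i : (a < q)%N -> ord_res (ords (a * m) (low_ord i)) = i.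
Proof. by move=> aq; apply: val_inj; rewrite /= ords_low_ord // modnMDl modn_small. Qed.

Lemma ord_quoE a i : (a < q)%N -> ord_quo (ords (a * m) (low_ord i)) = a :> nat.
Proof. by move=> aq; rewrite /= ords_low_ord // divnMDl // divn_small ?addn0. Qed.

Lemma ord_res_quo u : ords (ord_quo u * m) (low_ord (ord_res u)) = u.
Proof. by apply: val_inj; rewrite /= ords_low_ord -?divn_eq // ord_quo_subproof. Qed.

Lemma ord_res_quo_eq (u : 'I_n) (i : 'I_m) :
  (u %% m = i)%N -> ords (ord_quo u * m) (low_ord i) = u.
Proof. by move=> ui; rewrite -(_ : ord_res u = i) ?ord_res_quo //; apply: val_inj. Qed.

Lemma ords_low_ord_bij : bijective (fun ia : 'I_m * 'I_q => ords (ia.2 * m) (low_ord ia.1)).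
Proof.
exists (fun u => (ord_res u, ord_quo u)) => [[i a]|u] /=; last exact: ord_res_quo.
by rewrite ord_resE //; congr (_, _); apply: val_inj; exact: ord_quoE.
Qed.

Variable dim : 'I_n -> nat.
Hypothesis dimE : forall u, dim (ords m u) = dim u.

Lemma dim_ords a u : dim (ords (a * m) u) = dim u.
Proof. exact: (ords_invariant dimE). Qed.

Lemma dim_res u : dim (low_ord (ord_res u)) = dim u.
Proof. by rewrite -[in RHS](ord_res_quo u) dim_ords. Qed.

(** The shift by m decomposes the indices into m cycles of length q, and the
    factor of u only involves the values of J at u and at its successor, so the sum
    factors over these cycles. *)
Lemma sum_shift_cycles (B : 'I_n -> nat -> nat -> algC) :
  \sum_(J : {dffun forall u, 'I_(dim u)}) \prod_u B u (J (ords m u)) (J u) =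
  \prod_(i < m) \sum_(K : {ffun 'I_q -> 'I_(dim (low_ord i))})
    \prod_(a < q) B (ords (a * m) (low_ord i)) (K (ordS a)) (K a).
Proof.
rewrite (big_distr_dffun (fun (i : 'I_m) (K : {ffun 'I_q -> 'I_(dim (low_ord i))}) =>
   \prod_(a < q) B (ords (a * m) (low_ord i)) (K (ordS a)) (K a))) /=.
pose toK (J : {dffun forall u, 'I_(dim u)}) :
    {dffun forall i : 'I_m, {ffun 'I_q -> 'I_(dim (low_ord i))}} :=
  [ffun i => [ffun a : 'I_q => cast_ord (dim_ords a (low_ord i)) (J (ords (a * m) (low_ord i)))]].
pose toJ (K : {dffun forall i : 'I_m, {ffun 'I_q -> 'I_(dim (low_ord i))}}) :
    {dffun forall u, 'I_(dim u)} :=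
  [ffun u => cast_ord (dim_res u) (K (ord_res u) (ord_quo u))].
have JE (J : {dffun forall u, 'I_(dim u)}) u v : u = v -> J u = J v :> nat by move=> ->.
have KE (K : {dffun forall i : 'I_m, {ffun 'I_q -> 'I_(dim (low_ord i))}}) i j a b :
  i = j -> a = b -> K i a = K j b :> nat by move=> -> ->.
have toJK : cancel toJ toK.
  move=> K; apply/ffunP=> i; rewrite ffunE; apply/ffunP=> a; rewrite ffunE.
  apply: val_inj; rewrite /= ffunE /=; apply: KE; first exact: ord_resE.
  by apply: val_inj; exact: ord_quoE.
have toKJ : cancel toK toJ.
  move=> J; apply/ffunP=> u; rewrite ffunE; apply: val_inj; rewrite /= !ffunE /=.
  by apply: JE; rewrite ord_res_quo.
rewrite [RHS](reindex toK) /=; last by apply: onW_bij; exists toJ.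
apply: eq_bigr => J _; rewrite [RHS]pair_bigA /=.
rewrite (reindex _ (onW_bij _ ords_low_ord_bij)) /=.
apply: eq_bigr => [[i a] _]; rewrite /= !ffunE /=; congr B.
apply: JE; rewrite ordsD -mulSn; have [aq|] := ltnP a.+1 q; first by rewrite modn_small.
move=> qa; have -> : a.+1 = q by apply/eqP; rewrite eqn_leq qa ltn_ord.
by rewrite modnn -nE -[n in ords n]mul1n ords_mul.
Qed.
End ShiftFactor.

(** * Colourings that drop by a fixed amount along a permutation *)

(** The lengths are divided by q because they are those of the cycles of s^q on one
    colour class; i is the residue modulo m of the colour of the base point x A. *)
Definition colour_cycles n r (s : 'S_r) (m q : nat) (x : orb s -> 'I_r)
    (f : 'I_r -> 'I_n) (i : nat) : seq nat :=
  [seq #|val A| %/ q | A : orb s <- enum {: orb s} & f (x A) %% m == i]%N.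

Section Equivariant.
Variables (n m q r : nat) (s : 'S_r).
Hypotheses (m0 : (0 < m)%N) (q0 : (0 < q)%N) (nE : n = (q * m)%N).
Variable f : 'I_r -> 'I_n.
Hypothesis fE : forall k, f k = ords m (f (s k)).

Lemma equivariantX j k : f k = ords (j * m) (f ((s ^+ j)%g k)).
Proof.
elim: j => [|j IH]; first by rewrite perm1.
by rewrite IH fE ordsD -mulSnr expgSr permM.
Qed.

Lemma equivariant_res k : (f (s k) %% m = f k %% m)%N.
Proof. by rewrite (fE k) ordsE modn_dvdm ?modnDr // nE dvdn_mull. Qed.

Lemma equivariant_resX j k : (f ((s ^+ j)%g k) %% m = f k %% m)%N.
Proof. by elim: j => [|j IH]; rewrite ?perm1 // expgSr permM equivariant_res. Qed.

Lemma equivariant_res_orbit A k l : A \in porbits s -> k \in A -> l \in A ->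
  (f k %% m = f l %% m)%N.
Proof.
move=> sA kA; rewrite (porbitsE sA kA) => /porbitP[j ->].
by rewrite equivariant_resX.
Qed.

(** Along j steps the colour changes by j m, which is 0 modulo q m only if q divides j. *)
Lemma equivariant_fix j k : f ((s ^+ j)%g k) = f k -> (q %| j)%N.
Proof.
move=> fj; have := congr1 val (equivariantX j k); rewrite fj /= ordsE.
move/eqP; rewrite -{1}(modn_small (ltn_ord (f k))) -{1}[f k : nat]addn0 eqn_modDl.
by rewrite mod0n eq_sym -/(dvdn _ _) [X in dvdn X _]nE dvdn_pmul2r.
Qed.

Lemma equivariant_dvd A : A \in porbits s -> (q %| #|A|)%N.
Proof.
case/imsetP=> k _ ->; by apply: (@equivariant_fix _ k); rewrite permX_card_porbit.
Qed.

Lemma equivariant_reach (i : 'I_n) k : (f k %% m = i)%N ->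
  exists j, f ((s ^+ j)%g k) = i.
Proof.
move=> fki; exists (f k %/ m)%N; apply: (@ords_inj _ (f k %/ m * m)).
rewrite -equivariantX; apply: val_inj; rewrite /= ordsE addnC -fki -divn_eq.
by rewrite modn_small.
Qed.

(** Here t is the action of s^q on the colour class of i, transported by the
    parametrization y of this class.  A power of s that maps a point of the class
    into the class is a power of s^q, so a cycle of s meets the class in at most one
    cycle of s^q, and it does so exactly when its colours are i modulo m. *)
Lemma cyctype_colour_class (i : 'I_n) (N : nat) (t : 'S_N) (y : 'I_N -> 'I_r)
    (x : orb s -> 'I_r) :
  (i < m)%N -> (forall A, x A \in val A) ->
  injective y -> (forall j, f (y j) = i) -> (forall k, f k = i -> exists j, k = y j) ->
  (forall j, y (t j) = (s ^+ q)%g (y j)) ->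
  perm_eq (cyctype t) (colour_cycles m q x f i).
Proof.
move=> im xA y_inj fy y_onto yt.
have ytX a j : y ((t ^+ a)%g j) = (s ^+ (q * a))%g (y j).
  elim: a => [|a IH]; first by rewrite muln0 !perm1.
  by rewrite expgSr (permM (t ^+ a)%g) yt IH mulnSr expgD (permM (s ^+ (q * a))%g).
(* s^a fixes y j exactly when q divides a and t^(a/q) fixes j. *)
have card_y j : (#|porbit s (y j)| = q * #|porbit t j|)%N.
  apply/eqP; rewrite eqn_dvd; apply/andP; split.
    by rewrite -(porbit_period s (y j)) -(ytX #|porbit t j| j) permX_card_porbit.
  have /dvdnP[a E] := equivariant_dvd (mem_porbits s (y j)).
  rewrite E (mulnC a) dvdn_pmul2l // -(porbit_period t j); apply/eqP/y_inj.
  by rewrite ytX mulnC -E permX_card_porbit.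
pose Phi (O : {set 'I_N}) := \bigcup_(j in O) porbit s (y j).
have PhiE j : Phi (porbit t j) = porbit s (y j).
  apply/setP=> k; apply/bigcupP/idP => [[_ /porbitP[a ->]]|kj].
    rewrite ytX; have /eqP-> // : porbit s ((s ^+ (q * a))%g (y j)) == porbit s (y j).
    by rewrite eq_porbit_mem mem_porbit.
  by exists j; rewrite ?porbit_id.
have Phi_inj : {in porbits t &, injective Phi}.
  move=> _ _ /imsetP[j _ ->] /imsetP[l _ ->]; rewrite !PhiE => E.
  have /porbitP[a ya] : y l \in porbit s (y j) by rewrite E porbit_id.
  have /dvdnP[b ab] : (q %| a)%N by apply: (@equivariant_fix _ (y j)); rewrite -ya !fy.
  apply/eqP; rewrite eq_porbit_mem porbit_sym.
  have -> : l = (t ^+ b)%g j by apply: y_inj; rewrite ytX ya ab mulnC.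
  exact: mem_porbit.
pose len (B : {set 'I_r}) := (#|B| %/ q)%N.
have -> : cyctype t = [seq len B | B <- [seq Phi C | C : {set 'I_N} <- enum (porbits t)]].
  rewrite -map_comp; apply/eq_in_map => O; rewrite mem_enum => /imsetP[j _ ->] /=.
  by rewrite PhiE /len card_y mulKn.
rewrite /colour_cycles (map_comp len val); apply: perm_map.
apply: uniq_perm.
- by rewrite map_inj_in_uniq ?enum_uniq // => O P; rewrite !mem_enum; apply: Phi_inj.
- by rewrite (map_inj_uniq val_inj) filter_uniq ?enum_uniq.
move=> B; apply/mapP/mapP => [[O]|[A]].
  rewrite mem_enum => /imsetP[j _ ->] ->; rewrite PhiE.
  exists (exist _ (porbit s (y j)) (mem_porbits s (y j))) => //.
  rewrite mem_filter mem_enum andbT; apply/eqP.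
  set A := exist _ _ _.
  rewrite (@equivariant_res_orbit (val A) _ (y j)) ?mem_porbits ?porbit_id ?xA //.
  by rewrite fy modn_small.
rewrite mem_filter => /andP[/eqP /equivariant_reach[a fa] _] ->.
have [j jE] := y_onto _ fa.
exists (porbit t j); first by rewrite mem_enum mem_porbits.
rewrite PhiE -jE; apply: porbitsE (valP A) _.
have := mem_porbit s a (x A); by rewrite -(porbitsE (valP A) (xA A)).
Qed.
End Equivariant.

Definition nat_of_perm N (s : 'S_N) (k : nat) : nat :=
  if insub k is Some k' then s k' else k.
Definition perm_of_nat N (f : nat -> nat) : 'S_N :=
  insubd (1%g : 'S_N) [ffun k : 'I_N => insubd k (f k)].

Lemma nat_of_permE N (s : 'S_N) (k : 'I_N) : nat_of_perm s k = s k.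
Proof. by rewrite /nat_of_perm valK. Qed.

Lemma nat_of_permK N : cancel (@nat_of_perm N) (perm_of_nat N).
Proof.
move=> s; rewrite /perm_of_nat; set f := finfun _.
have -> : f = val s.
  apply/ffunP=> k; rewrite ffunE nat_of_permE; apply: val_inj.
  by rewrite val_insubd ltn_ord -pvalE.
by apply: val_inj; rewrite val_insubd; case: (s) => /= u ->.
Qed.

(** The entries of a Specht matrix with all indices coded by natural numbers.  The
    modules of two equal components of a multipartition can then be exchanged by
    rewriting the partition, without transport of bases. *)
Definition specht_coef (p : intpart) (f : nat -> nat) (x y : nat) : algC :=
  if (insub x, insub y) is (Some x', Some y')
  then specht_repr p (perm_of_nat (psize p) f) x' y' else 0.

Lemma specht_coefE p f (x y : 'I_(specht_dim p)) :
  specht_coef p f x y = specht_repr p (perm_of_nat (psize p) f) x y.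
Proof. by rewrite /specht_coef !valK. Qed.

Section ColourCount.
Variables (n m q r : nat) (s : 'S_r) (x : orb s -> 'I_r).
Hypotheses (m0 : (0 < m)%N) (q0 : (0 < q)%N) (nE : n = (q * m)%N).
Hypothesis xP : forall A, x A \in val A.

Definition equivariant (f : {ffun 'I_r -> 'I_n}) := [forall k, f k == ords m (f (s k))].

Lemma equivariantP (f : {ffun 'I_r -> 'I_n}) :
  reflect (forall k, f k = ords m (f (s k))) (equivariant f).
Proof. by apply: (iffP forallP) => H k; apply/eqP. Qed.

(** A power of s maps one colour class onto the other. *)
Lemma card_class_ords (f : {ffun 'I_r -> 'I_n}) j u : equivariant f ->
  #|[set k | f k == ords (j * m) u]| = #|[set k | f k == u]|.
Proof.
move=> /equivariantP fE; rewrite -[RHS](card_imset _ (@perm_inj _ (s ^- j)%g)).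
apply: eq_card => k; rewrite inE (equivariantX fE j) (inj_eq (@ords_inj _ _)).
apply/idP/imsetP => [fk|[l + ->]]; last by rewrite inE permKV.
by exists ((s ^+ j)%g k); rewrite ?inE // permK.
Qed.

(** All q classes with the same residue modulo m have the same size. *)
Lemma sumn_colour_cycles (f : {ffun 'I_r -> 'I_n}) (i : 'I_m) : equivariant f ->
  sumn (colour_cycles m q x f i) = #|[set k | f k == low_ord q0 nE i]|.
Proof.
move=> ef; have /equivariantP fE := ef; apply/eqP; rewrite -(eqn_pmul2l q0); apply/eqP.
rewrite sumnE big_map big_filter big_enum_cond /=.
transitivity (\sum_(k < r | f k %% m == i) 1)%N.
  rewrite [RHS]big_mkcond /= (big_orb s) /= big_distrr big_mkcond /=.
  apply: eq_bigr => A _; have fA k : k \in val A -> (f k %% m = f (x A) %% m)%N.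
    by move=> Ak; apply: (equivariant_res_orbit nE fE (valP A)); rewrite ?xP.
  rewrite mulnC divnK; last exact: (equivariant_dvd m0 nE fE (valP A)).
  rewrite (eq_bigr (fun=> (f (x A) %% m == i) : nat)%N) => [|k /fA ->]; last by case: eqP.
  by rewrite sum_nat_const; case: eqP; rewrite ?muln1 ?muln0.
rewrite (partition_big (fun k => ord_quo m0 nE (f k)) predT) //=.
rewrite (eq_bigr (fun=> #|[set k | f k == low_ord q0 nE i]|)) => [|a _].
  by rewrite sum_nat_const card_ord.
rewrite sum1dep_card -(card_class_ords a _ ef); apply: eq_card => k; rewrite !inE.
apply/andP/eqP => [[/eqP fi /eqP <-]|->].
  by rewrite ord_res_quo_eq.
split; apply/eqP; last by apply: val_inj; exact: ord_quoE.
by rewrite ords_low_ord // modnMDl modn_small.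
Qed.

Definition base_colours (f : {ffun 'I_r -> 'I_n}) : {ffun orb s -> 'I_n} := [ffun A => f (x A)].

Definition cycle_of (k : 'I_r) : orb s := exist _ (porbit s k) (mem_porbits s k).

Fact base_reaches k : exists a, k == (s ^+ a)%g (x (cycle_of k)).
Proof.
have : k \in porbit s (x (cycle_of k)).
  by rewrite porbit_sym -/(val (cycle_of k)) xP.
by case/porbitP=> a /eqP; exists a.
Qed.

Definition steps k := xchoose (base_reaches k).
Lemma stepsP k : k = (s ^+ steps k)%g (x (cycle_of k)).
Proof. exact/eqP/(xchooseP (base_reaches k)). Qed.

Lemma base_colours_inj : {in equivariant &, injective base_colours}.
Proof.
move=> f f' /equivariantP fE /equivariantP fE' /ffunP E; apply/ffunP=> k.
apply: (@ords_inj _ (steps k * m)); have := E (cycle_of k); rewrite !ffunE.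
by rewrite (equivariantX fE (steps k)) (equivariantX fE' (steps k)) -stepsP.
Qed.

(** The colour of s^a (x A) has to be psi A shifted back by a m.  This does not depend
    on the choice of a, because q divides the length of the cycle. *)
Lemma base_colours_onto (psi : {ffun orb s -> 'I_n}) :
  (forall A : orb s, q %| #|val A|)%N ->
  exists2 f, equivariant f & base_colours f = psi.
Proof.
move=> qA.
(* The shift is inverted instead of written as a shift by the opposite amount,
   since indices are natural numbers. *)
pose f := [ffun k => invF (@ords_inj n (steps k * m)) (psi (cycle_of k))].
have fP k : ords (steps k * m) (f k) = psi (cycle_of k) by rewrite ffunE f_invF.
have cardo A : porbit s (x A) = val A by rewrite -(porbitsE (valP A) (xP A)).
have modm a a' A : (s ^+ a)%g (x A) = (s ^+ a')%g (x A) -> (a * m = a' * m %[mod n])%N.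
  move/eqP; rewrite permX_eq cardo => /eqP E; rewrite [in LHS]nE [in RHS]nE -!muln_modl.
  congr (_ * _)%N; rewrite -(modn_dvdm a (qA A)) E modn_dvdm //.
exists f.
  apply/equivariantP=> k; apply: (@ords_inj _ (steps k * m)).
  have cs : cycle_of (s k) = cycle_of k by apply: val_inj; exact: porbit_perm_image.
  rewrite fP ordsD -cs -fP -mulSnr; apply: ords_mod; apply: (modm _ _ (cycle_of k)).
  by rewrite -{1}cs -stepsP expgSr permM -stepsP.
apply/ffunP=> A; rewrite ffunE.
have cx : cycle_of (x A) = A by apply: val_inj; exact: cardo.
rewrite -[in RHS]cx -fP -[LHS](ords_mul 0); apply: ords_mod.
rewrite mul0n -(mul0n m); apply: (modm _ _ A).
by rewrite perm1 [LHS]stepsP cx.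
Qed.

Lemma sum_equivariant (F : {ffun orb s -> 'I_n} -> algC) :
  \sum_(f | equivariant f) F (base_colours f) =
  if [forall A : orb s, q %| #|val A|]%N then \sum_psi F psi else 0.
Proof.
case: ifP => [/forallP qA|]; last first.
  move=> /negbT; rewrite negb_forall => /existsP[A nA]; rewrite big_pred0 // => f.
  apply: contraNF nA => /equivariantP fE; exact: (equivariant_dvd m0 nE fE (valP A)).
rewrite -(big_imset _ base_colours_inj) /=; apply: eq_bigl => psi.
have [f fE <-] := base_colours_onto psi qA.
by rewrite imset_f.
Qed.
End ColourCount.

(** * The trace of a shift composed with an element of G(n,1,r) *)

Fixpoint chain_perm N (s : nat -> 'S_N) k : 'S_N :=
  if k is k'.+1 then (s k' * chain_perm s k')%g else 1%g.

Lemma chain_mx_repr N d (rG : mx_representation algC [set: 'S_N] d) s k :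
  chain_mx (fun a => rG (s a)) k = rG (chain_perm s k).
Proof. by elim: k => [|k IH] /=; rewrite ?repr_mx1 // IH repr_mxM ?inE. Qed.

(** The permutations s a express t in the coordinates y a and y (a + 1), so their
    composition expresses a power of t. *)
Lemma chain_permE N (T : finType) (s : nat -> 'S_N) (t : {perm T}) (y : nat -> 'I_N -> T) k :
  (forall a j, (a < k)%N -> y a (s a j) = t (y a.+1 j)) ->
  forall j, y 0%N (chain_perm s k j) = (t ^+ k)%g (y k j).
Proof.
elim: k => [|k IH] H j; first by rewrite !perm1.
rewrite /= permM IH => [|a i ak]; last by rewrite H // ltnW.
by rewrite H // expgS permM.
Qed.

Lemma perm_of_nat_cast N N' (E : N = N') (t : 'S_N') j :
  cast_ord E (perm_of_nat N (nat_of_perm t) j) = t (cast_ord E j).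
Proof. by case: _ / E t j => t j; rewrite nat_of_permK !cast_ord_id. Qed.

Section Colourings.
Variables (n r : nat) (c : 'I_n -> nat) (Hr : (\sum_i c i)%N = r).
Implicit Type Y : split_of r c.

Definition colouring Y : {ffun 'I_r -> 'I_n} := [ffun k => xchoose (split_cover Y k)].

Lemma colouringP Y k i : (colouring Y k == i) = (k \in split_val Y i).
Proof.
have Yk := xchooseP (split_cover Y k); rewrite ffunE.
by apply/eqP/idP => [<- //|]; apply: split_disjoint Yk.
Qed.

Lemma colouring_mem Y k : k \in split_val Y (colouring Y k).
Proof. by rewrite -colouringP. Qed.

Lemma colouring_inj : injective colouring.
Proof.
move=> Y Z E; apply/val_inj/ffunP=> i; apply/setP=> k.
by rewrite -!colouringP E.
Qed.

Lemma card_colouring Y i : #|[set k | colouring Y k == i]| = c i.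
Proof. by rewrite -(split_card Y i); apply: eq_card => k; rewrite inE colouringP. Qed.

Lemma colouring_onto (f : {ffun 'I_r -> 'I_n}) :
  (forall i, #|[set k | f k == i]| = c i) -> exists Y, f = colouring Y.
Proof.
move=> H; have P : is_split c [ffun i => [set k | f k == i]].
  apply/and3P; split.
  - apply/forallP=> i; apply/forallP=> j; apply/implyP=> nij; rewrite !ffunE.
    apply/pred0P=> k /=; rewrite !inE; apply/negP=> /andP[/eqP fi /eqP fj].
    by rewrite -fi fj eqxx in nij.
  - rewrite eqEsubset subsetT; apply/subsetP=> k _; apply/bigcupP.
    by exists (f k); rewrite // ffunE inE.
  by apply/forallP=> i; rewrite ffunE H.
exists (Defs.Split P); apply/ffunP=> k; apply/esym/eqP.
by rewrite colouringP ffunE inE.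
Qed.

Lemma sum_colourings (F : {ffun 'I_r -> 'I_n} -> algC) :
  \sum_Y F (colouring Y) =
  \sum_(f : {ffun 'I_r -> 'I_n} | [forall i, #|[set k | f k == i]| == c i]) F f.
Proof.
rewrite (eq_bigl (mem (colouring @: predT))) => [|f]; last first.
  apply/forallP/imsetP => [H|[Y _ ->] i]; last by rewrite card_colouring.
  by have [|Y ->] := @colouring_onto f; [move=> i; apply/eqP | exists Y].
by rewrite big_imset //= => Y Z _ _; apply: colouring_inj.
Qed.

Lemma split_act_colouring (s : 'S_r) Y Z :
  (Y == split_act s Z) = [forall k, colouring Y (s k) == colouring Z k].
Proof.
apply/eqP/forallP => [-> k|H].
  by rewrite colouringP ffunE imset_f // colouring_mem.
apply/val_inj/ffunP=> i; apply/setP=> k; rewrite ffunE -colouringP.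
rewrite -[k](permKV s) (eqP (H _)) colouringP mem_imset //; exact: perm_inj.
Qed.

Lemma tX_blk Y i (j : 'I_(c i)) k0 :
  tX Hr Y (blk Hr j) = nth k0 (enum (split_val Y i)) j.
Proof.
rewrite permE /tX_fun blk_posK blk_indexK; apply: set_nth_default.
by rewrite -cardE split_card.
Qed.

Lemma tX_colour Y k : colouring Y (tX Hr Y k) = blk_index Hr k.
Proof. by apply/eqP; rewrite colouringP tX_in. Qed.
End Colourings.

Section Shift.
Variables (n r : nat) (lam : multipart r n) (k : nat).
Hypothesis lamE : forall u, lam (ords k u) = lam u.

Fact Xshift_subproof (X : Xset lam) :
  is_split (fun i => psize (lam i)) [ffun u => split_val X (ords k u)].
Proof.
apply/and3P; split.
- apply/forallP=> i; apply/forallP=> j; apply/implyP=> nij; rewrite !ffunE.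
  apply/pred0P=> x /=; apply/negP=> /andP[Xi Xj].
  by rewrite (ords_inj (split_disjoint Xi Xj)) eqxx in nij.
- rewrite eqEsubset subsetT; apply/subsetP=> x _; apply/bigcupP.
  have [i Xi] := split_cover X x; have [ord' _ ordK] := ords_bij n k.
  by exists (ord' i); rewrite // ffunE ordK.
by apply/forallP=> i; rewrite ffunE split_card lamE.
Qed.

Definition Xshift (X : Xset lam) : Xset lam := Defs.Split (Xshift_subproof X).

(** Positions of basis vectors are kept: the Specht modules of the two components
    have the same basis. *)
Definition Vshift (I : Vbasis lam) : Vbasis lam :=
  [ffun u => cast_ord (congr1 specht_dim (lamE u)) (I (ords k u))].

Definition Wshift (XI : Wbasis lam) : Wbasis lam := (Xshift XI.1, Vshift XI.2).

Lemma XshiftE X u : split_val (Xshift X) u = split_val X (ords k u).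
Proof. by rewrite ffunE. Qed.

Lemma VshiftE I u : Vshift I u = I (ords k u) :> nat.
Proof. by rewrite ffunE. Qed.

Lemma colouring_shift X x : ords k (colouring (Xshift X) x) = colouring X x.
Proof. by apply/esym/eqP; rewrite colouringP -XshiftE colouring_mem. Qed.

(** The trace of rho(g) followed by the permutation of the basis induced by the shift
    of indices by k. *)
Definition shift_trace (g : wreath n r) : algC :=
  \sum_(YJ : Wbasis lam) Wcoef g YJ (Wshift YJ).
End Shift.

Section ShiftTrace.
Variables (n m q r : nat) (lam : multipart r n).
Hypotheses (m0 : (0 < m)%N) (q0 : (0 < q)%N) (nE : n = (q * m)%N).
Hypothesis lamE : forall u, lam (ords m u) = lam u.
Let c (i : 'I_n) : nat := psize (lam i).
Let Hr : (\sum_i c i)%N = r := eqP (mvalP lam).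
Variables (g : wreath n r) (x : orb (ws g) -> 'I_r).
Hypothesis xP : forall A, x A \in val A.

Lemma Vcoef_scalar (Y : Xset lam) (s : wreath n r) (X : Xset lam) :
  s = ((tXG Y)^-1 * g * tXG X)%g ->
  \prod_i \prod_(k in blkset Hr i) rootU_val (wz s k) ^+ i =
  \prod_k rootU_val (wz g k) ^+ colouring Y k.
Proof.
move=> ->; rewrite [RHS](reindex_inj (@perm_inj _ (tX Hr Y))) /=.
rewrite [RHS](partition_big (blk_index Hr) predT) //=; apply: eq_bigr => i _.
apply: eq_big => [k|k]; rewrite mem_blkset // => /eqP ki.
rewrite tX_colour ki !ffunE invg1 mul1g invgK mulg1.
by [].
Qed.

(** The matrices of the Specht module attached to the indices i, i + m, i + 2m, ...
    are the coordinates of s between consecutive colour classes, and their product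
    is the matrix of s^q on the class of i. *)
Lemma sum_Vcoef (Y : Xset lam) : Y = split_act (ws g) (Xshift lamE Y) ->
  \sum_J Vcoef ((tXG Y)^-1 * g * tXG (Xshift lamE Y))%g J (Vshift lamE J) =
  \prod_k rootU_val (wz g k) ^+ colouring Y k *
  \prod_(i < n | (i < m)%N) specht_char (lam i) (colour_cycles m q x (colouring Y) i).
Proof.
move=> YE; set h := (_ * _ * _)%g.
have hE : h \in Gc lam by rewrite tXG_coset; apply/eqP.
have fE k : colouring Y k = ords m (colouring Y (ws g k)).
  have /eqP := YE; rewrite split_act_colouring => /forallP/(_ k)/eqP ->.
  by rewrite colouring_shift.
rewrite /Vcoef -mulr_sumr (Vcoef_scalar (erefl h)); congr (_ * _).
pose F u := nat_of_perm (blk_perm Hr u (ws h)).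
have dimE u : specht_dim (lam (ords m u)) = specht_dim (lam u) by rewrite lamE.
transitivity (\sum_(J : Vbasis lam) \prod_u
    specht_coef (lam u) (F u) (J (ords m u)) (J u)).
  apply: eq_bigr => J _; apply: eq_bigr => u _.
  by rewrite -VshiftE specht_coefE nat_of_permK.
rewrite (sum_shift_cycles m0 q0 nE dimE (fun u => specht_coef (lam u) (F u))).
rewrite [RHS](big_ord_narrow (leq_modulus q0 nE)) /=.
apply: eq_bigr => i _; rewrite -/(low_ord q0 nE i).
pose p := lam (low_ord q0 nE i); pose u a := ords (a * m) (low_ord q0 nE i).
have lamu a : lam (u a) = p by apply: (ords_invariant lamE).
pose s a : 'S_(psize p) := perm_of_nat (psize p) (F (u a)).
transitivity (\tr (specht_repr p (chain_perm s q))).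
  rewrite -chain_mx_repr -cycle_sum //; apply: eq_bigr => K _.
  by apply: eq_bigr => a _; rewrite -/(u a) lamu specht_coefE.
have cu a : psize p = c (u a) by rewrite /c lamu.
pose y a (j : 'I_(psize p)) := tX Hr Y (blk Hr (cast_ord (cu a) j)).
have ys a j : y a (s a j) = ws g (y a.+1 j).
  rewrite /y perm_of_nat_cast blk_permE -?GcE //.
  have hk k : tX Hr Y (ws h k) = ws g (tX Hr (Xshift lamE Y) k).
    by rewrite /h !wsM wsV /= !permM permKV.
  rewrite hk; congr (ws g _); rewrite (tX_blk Hr _ _ (y a.+1 j)) XshiftE.
  by rewrite [RHS](tX_blk Hr _ _ (y a.+1 j)) /= /u mulSn -ordsD.
rewrite -(specht_charE (perm_refl _)); apply: eq_specht_char.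
apply: (@cyctype_colour_class n m q r (ws g) m0 q0 nE _ fE (low_ord q0 nE i) _ _ (y 0%N)) => //.
- exact: (ltn_ord i).
- by move=> j l /perm_inj /blk_inj /cast_ord_inj.
- by move=> j; rewrite tX_colour blk_indexK.
- move=> k fk; pose k' := (tX Hr Y)^-1%g k.
  have : k' \in blkset Hr (u 0%N).
    by rewrite mem_blkset -(tX_colour Hr Y) permKV fk.
  case/imsetP=> j _ jE; exists (cast_ord (esym (cu 0%N)) j).
  by rewrite /y cast_ordKV -jE permKV.
move=> j; rewrite (@chain_permE _ _ s (ws g) y) //.
congr (_ _); rewrite [LHS](tX_blk Hr _ _ (y 0%N j)) [RHS](tX_blk Hr _ _ (y 0%N j)) /=.
by rewrite /u -nE -[n in ords n]mul1n ords_mul.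
Qed.

Lemma shift_trace_colourings :
  shift_trace lamE g =
  \sum_(f : {ffun 'I_r -> 'I_n} | [forall k, f k == ords m (f (ws g k))] &&
                       [forall i, #|[set k | f k == i]| == psize (lam i)])
    \prod_k rootU_val (wz g k) ^+ f k *
    \prod_(i < n | (i < m)%N) specht_char (lam i) (colour_cycles m q x f i).
Proof.
rewrite (eq_bigl _ _ (fun f => andbC _ _)) big_mkcondr /=.
rewrite -(sum_colourings (fun i => psize (lam i)) (fun f =>
 if [forall k, f k == ords m (f (ws g k))] then
    \prod_k rootU_val (wz g k) ^+ f k *
    \prod_(i < n | (i < m)%N) specht_char (lam i) (colour_cycles m q x f i) else 0)).
rewrite /shift_trace.
rewrite (eq_bigr (fun YJ : Wbasis lam => Wcoef g (YJ.1, YJ.2)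
   (Xshift lamE YJ.1, Vshift lamE YJ.2))); last by case.
rewrite -(pair_bigA _ (fun Y J => Wcoef g (Y, J) (Xshift lamE Y, Vshift lamE J))) /=.
apply: eq_bigr => Y _; rewrite /Wcoef /= tXG_coset split_act_colouring.
have -> : [forall k, colouring Y (ws g k) == colouring (Xshift lamE Y) k] =
   [forall k, colouring Y k == ords m (colouring Y (ws g k))].
  apply: eq_forallb => k; rewrite -[colouring Y k](colouring_shift lamE).
  by rewrite (inj_eq (@ords_inj _ _)) eq_sym.
case: ifP => [H|_]; last by rewrite big1.
apply: sum_Vcoef; apply/eqP; rewrite split_act_colouring.
apply/forallP=> k; rewrite -(inj_eq (@ords_inj _ m)) colouring_shift eq_sym.
exact: (forallP H).
Qed.
End ShiftTrace.

(** * From colourings to a sum over the cycles *)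

Section Residues.
Variables (n m q : nat) (J : finType) (xi : J -> algC).
Hypotheses (m0 : (0 < m)%N) (q0 : (0 < q)%N) (nE : n = (q * m)%N).
Hypothesis xin : forall A, xi A ^+ n = 1.

(** A geometric sum of ratio z^m, and z^(qm) = 1. *)
Lemma sum_residue_class (z : algC) (i : 'I_n) : (i < m)%N -> z ^+ n = 1 ->
  \sum_(u < n | (u %% m == i)%N) z ^+ u = if z ^+ m == 1 then q%:R * z ^+ i else 0.
Proof.
move=> im zn; pose i' := Ordinal im.
have iE : low_ord q0 nE i' = i by apply: val_inj.
have -> : \sum_(u < n | (u %% m == i)%N) z ^+ u = z ^+ i * \sum_(a < q) (z ^+ m) ^+ a.
  rewrite (reindex_onto (fun a : 'I_q => ords (a * m) i) (ord_quo m0 nE)) /=.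
    rewrite mulr_sumr; apply: eq_big => [a|a _].
      rewrite -iE ords_low_ord // modnMDl modn_small // eqxx; apply/eqP/val_inj.
      exact: ord_quoE.
    by rewrite -iE ords_low_ord // addnC exprD mulnC exprM.
  by move=> u /eqP ui; rewrite -iE ord_res_quo_eq.
case: eqP => [->|/eqP zm].
  rewrite (eq_bigr (fun=> 1)) => [|a _]; last by rewrite expr1n.
  by rewrite sumr_const card_ord mulrC.
apply/eqP; rewrite mulf_eq0; apply/orP; right.
have /eqP := subrX1 (z ^+ m) q; rewrite -exprM mulnC -nE zn subrr eq_sym mulf_eq0.
by rewrite subr_eq0 (negbTE zm).
Qed.

(** A cycle A of colour phi A < top contributes the scalar xi A ^ phi A and a part len A to
    the argument of the character of p_(phi A). *)
Definition colour_sum (top : nat) (len : J -> nat) (p : 'I_n -> intpart) : algC :=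
  \sum_(phi : {ffun J -> 'I_n} | [forall A, phi A < top]%N)
    \prod_A xi A ^+ phi A *
    \prod_(i < n | (i < top)%N) specht_char (p i) [seq len A | A <- enum J & phi A == i :> nat].

(** The characters only see the residues modulo m, so for fixed residues the scalars
    can be summed cycle by cycle. *)
Lemma sum_residues (len : J -> nat) (p : 'I_n -> intpart) :
  \sum_(psi : {ffun J -> 'I_n}) \prod_A xi A ^+ psi A *
    \prod_(i < n | (i < m)%N) specht_char (p i) [seq len A | A <- enum J & psi A %% m == i]%N =
  if [forall A, xi A ^+ m == 1] then q%:R ^+ #|J| * colour_sum m len p else 0.
Proof.
pose res (psi : {ffun J -> 'I_n}) := [ffun A => low_ord q0 nE (ord_res m0 (psi A))].
rewrite (partition_big res (fun phi => [forall A, phi A < m]%N)) /=; last first.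
  by move=> psi _; apply/forallP=> A; rewrite ffunE /= ltn_pmod.
transitivity (\sum_(phi : {ffun J -> 'I_n} | [forall A, phi A < m]%N)
   (\prod_A if xi A ^+ m == 1 then q%:R * xi A ^+ phi A else 0) *
   \prod_(i < n | (i < m)%N) specht_char (p i) [seq len A | A <- enum J & phi A == i :> nat]).
  apply: eq_bigr => phi /forallP phim.
  have resP psi : (res psi == phi) = (psi \in family (fun A (u : 'I_n) => u %% m == phi A)%N).
    apply/eqP/familyP => [<- A|H]; first by rewrite unfold_in ffunE.
    by apply/ffunP=> A; rewrite ffunE; apply/val_inj/eqP/(H A).
  rewrite (eq_bigr (fun psi : {ffun J -> 'I_n} => \prod_A xi A ^+ psi A *
    \prod_(i < n | (i < m)%N) specht_char (p i) [seq len A | A <- enum J & phi A == i :> nat])).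
    rewrite -mulr_suml (eq_bigl _ _ resP).
    rewrite -(bigA_distr_big_dep (fun A (u : 'I_n) => (u %% m == phi A)%N)
                                 (fun A (u : 'I_n) => xi A ^+ u)).
    by congr (_ * _); apply: eq_bigr => A _; apply: sum_residue_class.
  move=> psi /eqP <-; congr (_ * _); apply: eq_bigr => i _; congr (specht_char _ (map _ _)).
  by apply: eq_filter => A; rewrite ffunE.
case: ifP => [/forallP X|/negbT].
  rewrite mulr_sumr; apply: eq_bigr => phi _; rewrite mulrA; congr (_ * _).
  rewrite -prodr_const -big_split /=; apply: eq_bigr => A _; by rewrite X.
rewrite negb_forall => /existsP[A nA]; apply: big1 => phi _.
by rewrite (bigD1 A) //= (negbTE nA) !mul0r.
Qed.

(** A colour i >= m cannot be used, because the character of an empty partition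
    vanishes on nonempty cycle types. *)
Lemma colour_sum_head (len : J -> nat) (p : {ffun 'I_n -> intpart}) :
  colour_sum n len (head_part m p) = colour_sum m len p.
Proof.
have mn := leq_modulus q0 nE.
rewrite /colour_sum [RHS]big_mkcond [LHS]big_mkcond /=; apply: eq_bigr => phi _.
have -> : [forall A, phi A < n]%N by apply/forallP=> A.
rewrite (bigID (fun i : 'I_n => i < m)%N) /= .
case: ifP => [/forallP H|/negbT].
  rewrite [X in _ * (_ * X)]big1 ?mulr1 => [|i /andP[_ im]].
    congr (_ * _); apply: eq_big => [i|i /andP[_ im]]; first by rewrite ltn_ord.
    by rewrite ffunE im.
  rewrite ffunE (negbTE im) specht_char_empty (_ : filter _ _ = [::]) //.
  apply/eqP; rewrite -[_ == _]negbK -has_filter; apply/hasPn=> A _.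
  by apply: contraNneq im => <-.
rewrite negb_forall => /existsP[A nA]; apply/eqP; rewrite !mulf_eq0; apply/orP; right.
apply/orP; right; rewrite (bigD1 (phi A)) ?ltn_ord //= mulf_eq0; apply/orP; left.
rewrite ffunE (negbTE nA) specht_char_empty pnatr_eq0 eqb0 -size_eq0 size_map size_eq0 -has_filter.
by apply/hasP; exists A; rewrite ?mem_enum.
Qed.
End Residues.

Lemma colour_sum_bij n (J J' : finType) (xi : J -> algC) (xi' : J' -> algC)
    top (len : J -> nat) (len' : J' -> nat) (p : 'I_n -> intpart) (h : J -> J') :
  bijective h -> (forall A, xi' (h A) = xi A) -> (forall A, len' (h A) = len A) ->
  colour_sum xi top len p = colour_sum xi' top len' p.
Proof.
case=> h' hK h'K xiE lenE; rewrite /colour_sum.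
pose H (phi : {ffun J' -> 'I_n}) : {ffun J -> 'I_n} := [ffun A => phi (h A)].
pose H' (phi : {ffun J -> 'I_n}) : {ffun J' -> 'I_n} := [ffun A => phi (h' A)].
rewrite (reindex H) /=; last first.
  apply: onW_bij; exists H' => phi; apply/ffunP=> A; rewrite !ffunE ?h'K ?hK //.
apply: eq_big => [phi|phi _].
  apply/forallP/forallP => P A; last by rewrite ffunE.
  by have := P (h' A); rewrite ffunE h'K.
congr (_ * _).
  rewrite [RHS](reindex h) /=; last by apply: onW_bij; exists h'.
  by apply: eq_bigr => A _; rewrite ffunE xiE.
apply: eq_bigr => i _; apply: eq_specht_char.
rewrite (eq_map (fun A => esym (lenE A))) (map_comp len' h) perm_map //.
rewrite (eq_filter (a2 := preim h (fun B => phi B == i :> nat))) => [|A]; last by rewrite /= ffunE.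
rewrite -filter_map perm_filter // uniq_perm ?enum_uniq //.
  by rewrite map_inj_uniq ?enum_uniq //; apply: can_inj hK.
by move=> B; rewrite mem_enum inE; apply/mapP; exists (h' B); rewrite ?mem_enum ?h'K.
Qed.

Lemma cycprod_root n r (g : wreath n r) A : (0 < n)%N -> cycprod g A ^+ n = 1.
Proof.
move=> n0; rewrite /cycprod -prodrXl big1 // => k _.
by rewrite -[n in _ ^+ n]prednK // (eqP (rootU_valP _)).
Qed.

Section ShiftTraceCycles.
Variables (n m q r : nat) (lam : multipart r n).
Hypotheses (m0 : (0 < m)%N) (q0 : (0 < q)%N) (nE : n = (q * m)%N).
Hypothesis lamE : forall u, lam (ords m u) = lam u.
Variables (g : wreath n r) (x : orb (ws g) -> 'I_r).
Hypothesis xP : forall A, x A \in val A.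

(** A nonzero value of a Specht character determines the size of its colour class,
    which gives back the condition on the sizes of the sets X_i. *)
Lemma card_colour_class (f : {ffun 'I_r -> 'I_n}) u : equivariant m (ws g) f ->
  \prod_(i < n | (i < m)%N) specht_char (lam i) (colour_cycles m q x f i) != 0 ->
  #|[set k | f k == u]| = psize (lam u).
Proof.
move=> fE; rewrite (big_ord_narrow (leq_modulus q0 nE)) => /prodf_neq0 nz.
pose i := ord_res m0 u.
have <- : #|[set k | f k == low_ord q0 nE i]| = psize (lam u).
  rewrite -(sumn_colour_cycles m0 q0 nE xP) // (specht_char_neq0 (nz i isT)).
  by rewrite -[in RHS](ord_res_quo m0 q0 nE u) (ords_invariant lamE).
by rewrite -{1}(ord_res_quo m0 q0 nE u) (card_class_ords (m := m) _ _ fE).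
Qed.

Lemma shift_trace_equivariant :
  shift_trace lamE g = \sum_(f : {ffun 'I_r -> 'I_n} | equivariant m (ws g) f)
    \prod_k rootU_val (wz g k) ^+ f k *
    \prod_(i < n | (i < m)%N) specht_char (lam i) (colour_cycles m q x f i).
Proof.
rewrite (shift_trace_colourings m0 q0 nE lamE xP) big_mkcondr; apply: eq_bigr => f fE.
case: ifP => // /negbT; apply: contraNeq; rewrite eq_sym mulf_eq0 negb_or => /andP[_ nz].
by apply/forallP=> u; rewrite (card_colour_class _ fE nz).
Qed.

Hypothesis zP : forall f : {ffun 'I_r -> 'I_n}, equivariant m (ws g) f ->
  \prod_k rootU_val (wz g k) ^+ f k = \prod_A cycprod g (val A) ^+ f (x A).

Lemma shift_trace_cycles :
  shift_trace lamE g =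
  if [forall A : orb (ws g), q %| #|val A|]%N &&
     [forall A : orb (ws g), cycprod g (val A) ^+ m == 1]
  then q%:R ^+ #|{: orb (ws g)}| *
       colour_sum (fun A : orb (ws g) => cycprod g (val A)) m
         (fun A : orb (ws g) => #|val A| %/ q)%N lam
  else 0.
Proof.
have n0 : (0 < n)%N by rewrite nE muln_gt0 q0.
rewrite shift_trace_equivariant.
pose G (psi : {ffun orb (ws g) -> 'I_n}) := \prod_A cycprod g (val A) ^+ psi A *
    \prod_(i < n | (i < m)%N) specht_char (lam i)
      [seq #|val A| %/ q | A : orb (ws g) <- enum {: orb (ws g)} & psi A %% m == i]%N.
rewrite (eq_bigr (fun f => G (base_colours x f))) => [|f fE].
  rewrite (sum_equivariant m0 nE xP); case: ifP => //= _.
  by rewrite /G (sum_residues m0 q0 nE) // => A; apply: cycprod_root.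
rewrite zP // /G; congr (_ * _); first by apply: eq_bigr => A _; rewrite ffunE.
apply: eq_bigr => i _; congr (specht_char _ (map _ _)).
by apply: eq_filter => A; rewrite ffunE.
Qed.
End ShiftTraceCycles.

Section Characters.
Variables (n r : nat) (lam : multipart r n).

Lemma Wbasis_eq (XI YJ : Wbasis lam) :
  (forall u, split_val XI.1 u = split_val YJ.1 u) ->
  (forall u, XI.2 u = YJ.2 u :> nat) -> XI = YJ.
Proof.
case: XI YJ => [X I] [Y J] /= E1 E2; congr (_, _); first exact/val_inj/ffunP.
by apply/ffunP=> u; apply: val_inj; exact: E2.
Qed.

Lemma lam_ordsnn u : lam (ords n u) = lam u.
Proof. by rewrite ordsnn. Qed.

Lemma cfRepr_shift_trace g : cfRepr (W_repr lam) g = shift_trace lam_ordsnn g.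
Proof.
rewrite cfunE inE mulr1n /mxtrace /shift_trace.
rewrite (reindex _ (onW_bij _ (enum_val_bij (Wbasis lam)))) /=.
apply: eq_bigr => i _; rewrite mxE; congr Wcoef.
by apply: Wbasis_eq => u /=; rewrite ?ffunE /= ordsnn.
Qed.

Hypothesis n0 : (0 < n)%N.

Lemma cfRepr_colourings g (x : orb (ws g) -> 'I_r) : (forall A, x A \in val A) ->
  cfRepr (W_repr lam) g = \sum_(f : {ffun 'I_r -> 'I_n} | equivariant n (ws g) f)
    \prod_k rootU_val (wz g k) ^+ f k *
    \prod_(i < n) specht_char (lam i) (colour_cycles n 1 x f i).
Proof.
move=> xP; rewrite cfRepr_shift_trace.
rewrite (shift_trace_equivariant n0 (ltn0Sn 0) (esym (mul1n n)) _ xP).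
apply: eq_bigr => f _; congr (_ * _); apply: eq_bigl => i; exact: ltn_ord.
Qed.

(** The case m = n of the computation: admissible colourings are constant along
    cycles, and every element g is allowed. *)
Lemma cfRepr_cycles g : cfRepr (W_repr lam) g =
  colour_sum (fun A : orb (ws g) => cycprod g (val A)) n
     (fun A : orb (ws g) => #|val A|) lam.
Proof.
have [x xP] := orbit_bases (ws g).
rewrite cfRepr_shift_trace (shift_trace_cycles n0 (ltn0Sn 0) (esym (mul1n n)) _ xP).
  have -> /= : [forall A : orb (ws g), 1 %| #|val A|]%N.
    by apply/forallP=> A; rewrite dvd1n.
  have -> : [forall A : orb (ws g), cycprod g (val A) ^+ n == 1].
    by apply/forallP=> A; rewrite cycprod_root.
  rewrite expr1n mul1r; apply: (@colour_sum_bij n _ _ _ _ n _ _ lam id) => //.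
    by exists id.
  by move=> A; rewrite divn1.
move=> f /equivariantP fE; rewrite (big_orb (ws g)); apply: eq_bigr => A _.
rewrite -prodrXl; apply: eq_bigr => k Ak; congr (_ ^+ _).
have := equivariant_res_orbit (esym (mul1n n)) fE (valP A) Ak (xP A).
by rewrite !modn_small.
Qed.
End Characters.

Section DeltaShift.
Variables (d e r : nat) (lam : multipart r (d * e)) (b : nat).
Hypothesis lamE : forall u, lam (ords (d * b) u) = lam u.

Let lamEk k := ords_invariant lamE k.

Lemma M_mxX k :
  M_mx lam b ^+ k =
  \matrix_(i, j) (enum_val i == Wshift (lamEk k) (enum_val j))%:R.
Proof.
elim: k => [|k IH].
  rewrite expr0; apply/matrixP=> i j; rewrite !mxE -(inj_eq enum_val_inj).
  congr (_ == _)%:R; apply: Wbasis_eq => u; by rewrite /= ?ffunE.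
rewrite exprS IH; apply/matrixP=> i j; rewrite !mxE.
rewrite (bigD1 (enum_rank (Wshift (lamEk k) (enum_val j)))) //= !mxE enum_rankK eqxx mulr1.
rewrite big1 ?addr0 => [|l nl]; last first.
  by rewrite !mxE -(inj_eq enum_val_inj) enum_rankK in nl *; rewrite (negbTE nl) mulr0.
rewrite /Mcoef; congr (_ : bool)%:R; apply/andP/eqP => [[/eqP E1 /forallP E2]|->].
  apply: Wbasis_eq => u; first by rewrite E1 !ffunE /= ordsD addnC mulSn.
  by rewrite (eqP (E2 u)) /= !VshiftE ordsD addnC mulSn.
split; first by apply/eqP/ffunP=> u; rewrite !ffunE /= ordsD addnC mulSn.
by apply/forallP=> u; rewrite /= !VshiftE ordsD addnC mulSn.
Qed.

Lemma Delta_shift_trace k g : Delta lam b k g = shift_trace (lamEk k) g.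
Proof.
rewrite /Delta M_mxX /mxtrace; under eq_bigr => i _ do rewrite mxE.
rewrite exchange_big /= /shift_trace.
rewrite [RHS](reindex _ (onW_bij _ (enum_val_bij (Wbasis lam)))) /=.
apply: eq_bigr => j _.
rewrite (bigD1 (enum_rank (Wshift (lamEk k) (enum_val j)))) //= !mxE enum_rankK eqxx mul1r.
rewrite big1 ?addr0 // => l nl.
by rewrite mxE -(inj_eq enum_val_inj) enum_rankK in nl *; rewrite (negbTE nl) mul0r.
Qed.
End DeltaShift.

(** * The stabilizer of the module forces the multipartition to be periodic *)

Section Fourier.
Variables (n r : nat).
Hypothesis n0 : (0 < n)%N.

Lemma rootU_expn (w : rootU n) : rootU_val w ^+ n = 1.
Proof. by rewrite -[n in _ ^+ n]prednK // (eqP (rootU_valP w)). Qed.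

Lemma rootU_neq0 (w : rootU n) : rootU_val w != 0.
Proof.
by apply/eqP=> w0; have /eqP := rootU_expn w; rewrite w0 expr0n gtn_eqF // eq_sym oner_eq0.
Qed.

Lemma sum_rootU_char (a b : 'I_n) :
  \sum_(w : rootU n) rootU_val w ^+ a * (rootU_val w)^-1 ^+ b =
  if a == b then #|{: rootU n}|%:R else 0.
Proof.
case: eqP => [->|nab].
  rewrite (eq_bigr (fun=> 1)) ?sumr_const // => w _.
  by rewrite -exprMn mulfV ?rootU_neq0 // expr1n.
have [z zP] := C_prim_root_exists n0.
have zU : z ^+ n.-1.+1 == 1 by rewrite prednK // (prim_expr_order zP).
pose w0 := RootU zU; set S := \sum_w _.
have SE : S = (z ^+ a * z^-1 ^+ b) * S.
  rewrite {1}/S (reindex_inj (mulgI w0)) mulr_sumr; apply: eq_bigr => w _ /=.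
  by rewrite invfM !exprMn mulrACA.
apply/eqP; have /eqP := SE; rewrite -subr_eq0 -{1}[S]mul1r -mulrBl mulf_eq0.
case/orP=> // /eqP/eqP; rewrite subr_eq0 => /eqP E; case: nab.
have zb0 : z ^+ b != 0 by rewrite expf_neq0 // (rootU_neq0 w0).
have /eqP : z ^+ b = z ^+ a.
  by rewrite -[LHS]mul1r E -mulrA -exprMn mulVf ?expr1n ?mulr1 // (rootU_neq0 w0).
by rewrite (eq_prim_root_expr zP) !modn_small // => /eqP/esym/val_inj.
Qed.

(** Linear independence of the characters of the diagonal subgroup: the coefficient of
    f0 is recovered by averaging against the inverse of its character. *)
Lemma fourier_inj (P Q : {ffun 'I_r -> 'I_n} -> algC) :
  (forall z : {ffun 'I_r -> rootU n},
     \sum_(f : {ffun 'I_r -> 'I_n}) \prod_k rootU_val (z k) ^+ (f k) * P f =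
     \sum_(f : {ffun 'I_r -> 'I_n}) \prod_k rootU_val (z k) ^+ (f k) * Q f) -> P =1 Q.
Proof.
move=> E f0.
pose T (R : {ffun 'I_r -> 'I_n} -> algC) := \sum_(z : {ffun 'I_r -> rootU n})
   (\prod_k (rootU_val (z k))^-1 ^+ f0 k) *
   \sum_(f : {ffun 'I_r -> 'I_n}) \prod_k rootU_val (z k) ^+ (f k) * R f.
have TE R : T R = #|{: rootU n}|%:R ^+ r * R f0.
  transitivity (\sum_(f : {ffun 'I_r -> 'I_n})
    (\prod_k \sum_(w : rootU n) rootU_val w ^+ f k * (rootU_val w)^-1 ^+ f0 k) * R f).
    rewrite /T; under eq_bigr => z _ do rewrite mulr_sumr.
    rewrite exchange_big /=; apply: eq_bigr => f _.
    rewrite (bigA_distr_bigA (fun k (w : rootU n) =>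
      rootU_val w ^+ f k * (rootU_val w)^-1 ^+ f0 k)) mulr_suml.
    apply: eq_bigr => z _; rewrite mulrA mulrC -big_split /= mulrC; congr (_ * _).
    by apply: eq_bigr => k _; rewrite mulrC.
  rewrite (bigD1 f0) //= [X in _ + X]big1 ?addr0 => [|f nf].
    congr (_ * _); rewrite -[r in RHS]card_ord -prodr_const; apply: eq_bigr => k _.
    by rewrite sum_rootU_char eqxx.
  have /existsP[k nk] : [exists k, f k != f0 k].
    apply: contraR nf; rewrite negb_exists => /forallP H; apply/eqP/ffunP=> k.
    by apply/eqP; rewrite -[_ == _]negbK H.
  by rewrite (bigD1 k) //= sum_rootU_char (negbTE nk) !mul0r.
have cU : #|{: rootU n}|%:R ^+ r != 0 :> algC.
  rewrite expf_neq0 // pnatr_eq0 -lt0n; apply/card_gt0P; by exists 1%g.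
by apply: (mulfI cU); rewrite -!TE /T; apply: eq_bigr => z _; rewrite E.
Qed.
End Fourier.

(** A permutation of one block, extended by the identity. *)
Lemma blk_extension n r (c : 'I_n -> nat) (Hr : (\sum_i c i)%N = r) i0 (t : 'S_(c i0)) :
  exists (s : 'S_r) (ti : forall i, 'S_(c i)),
    [/\ forall i j, s (blk Hr j) = blk Hr (ti i j), ti i0 = t
      & forall i, i != i0 -> ti i = 1%g].
Proof.
pose ti i : 'S_(c i) := if i == i0 then perm_of_nat (c i) (nat_of_perm t) else 1%g.
pose f k := blk Hr (ti (blk_index Hr k) (blk_pos Hr k)).
have tiE i i' (j : 'I_(c i)) (j' : 'I_(c i')) :
  i = i' -> j = j' :> nat -> ti i j = ti i' j' :> nat.
  by move=> E; case: _ / E j' => j' /val_inj ->.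
have fE i j : f (blk Hr j) = blk Hr (ti i j).
  apply: (@blk_eq _ _ _ Hr); rewrite /f ?blk_indexK // !blk_posK.
  by apply: tiE; rewrite ?blk_indexK ?blk_posK.
have f_inj : injective f.
  move=> k l; rewrite -(blkK Hr k) -(blkK Hr l) !fE => E.
  have /(congr1 (blk_index Hr)) := E; rewrite !blk_indexK => Ei.
  apply: (@blk_eq _ _ _ Hr); rewrite ?blk_indexK // !blk_posK.
  have {E} := congr1 (fun k => blk_pos Hr k : nat) E; rewrite !blk_posK.
  move: (blk_pos Hr k) (blk_pos Hr l); case: _ / Ei => a b /val_inj /perm_inj ->.
  by [].
exists (perm f_inj), ti; split=> [i j||i ni]; first by rewrite permE fE.
  by rewrite /ti eqxx nat_of_permK.
by rewrite /ti (negbTE ni).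
Qed.

Section EpsInvariance.
Variables (d e r : nat) (lam : multipart r (d * e)) (b : nat).
Hypothesis n0 : (0 < d * e)%N.
Hypothesis epsE : forall g : wreath (d * e) r,
  eps g ^+ b * cfRepr (W_repr lam) g = cfRepr (W_repr lam) g.
Let n := (d * e)%N.
Let c (i : 'I_n) : nat := psize (lam i).
Let Hr : (\sum_i c i)%N = r := eqP (mvalP lam).
Let sh := @ords n (d * b).
Let n1 : n = (1 * n)%N := esym (mul1n n).

(** Multiplying by eps^b adds d b to all colours in the scalar of a colouring, so the
    coefficients of f and of the shifted f in the character agree. *)
Lemma eps_shift_coef (s : 'S_r) (x : orb s -> 'I_r) (f : {ffun 'I_r -> 'I_n}) :
  (forall A, x A \in val A) -> equivariant n s f ->
  \prod_(i < n) specht_char (lam i) (colour_cycles n 1 x [ffun k => sh (f k)] i) =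
  \prod_(i < n) specht_char (lam i) (colour_cycles n 1 x f i).
Proof.
move=> xP fE.
pose P (f : {ffun 'I_r -> 'I_n}) : algC := (equivariant n s f)%:R *
  \prod_(i < n) specht_char (lam i) (colour_cycles n 1 x f i).
pose up (f : {ffun 'I_r -> 'I_n}) : {ffun 'I_r -> 'I_n} := [ffun k => sh (f k)].
pose dn (f : {ffun 'I_r -> 'I_n}) : {ffun 'I_r -> 'I_n} :=
  [ffun k => invF (@ords_inj n (d * b)) (f k)].
have upK : cancel up dn by move=> f'; apply/ffunP=> k; rewrite !ffunE invF_f.
have dnK : cancel dn up by move=> f'; apply/ffunP=> k; rewrite !ffunE; apply: f_invF.
have chiE z : cfRepr (W_repr lam) (Wreath z s) =
    \sum_(f : {ffun 'I_r -> 'I_n}) \prod_k rootU_val (z k) ^+ f k * P f.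
  rewrite (@cfRepr_colourings n r lam n0 (Wreath z s) x xP) big_mkcond /=.
  apply: eq_bigr => f' _; rewrite /P; case: (equivariant _ _ _); first by rewrite mul1r.
  by rewrite mul0r mulr0.
have E : P \o dn =1 P.
  apply: (fourier_inj n0) => z; rewrite -chiE -epsE chiE mulr_sumr.
  rewrite [LHS](reindex up) /=; last by apply: onW_bij; exists dn.
  apply: eq_bigr => f' _; rewrite upK mulrA; congr (_ * _).
  rewrite /eps -exprM -prodrXl -big_split /=; apply: eq_bigr => k _.
  rewrite ffunE /= /sh ordsE -exprD.
  by rewrite addnC expr_mod // rootU_expn.
have := E (up f); rewrite /= upK /P fE.
have -> : equivariant n s (up f) = true.
  apply/equivariantP=> k; rewrite !ffunE ordsnn; congr sh.
  by have /equivariantP/(_ k) := fE; rewrite ordsnn.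
by rewrite !mul1r => ->.
Qed.

(** The previous identity for the colouring by blocks: the block of index i sees the
    partition lam_i on one side and lam_(i+db) on the other. *)
Lemma eps_shift_blocks (i0 : 'I_n) (t : 'S_(c i0)) :
  exists2 ti : forall i, 'S_(c i), ti i0 = t /\ (forall i, i != i0 -> ti i = 1%g) &
  \prod_(i < n) specht_char (lam (sh i)) (cyctype (ti i)) =
  \prod_(i < n) specht_char (lam i) (cyctype (ti i)).
Proof.
have [s [ti [sE t0 t1]]] := blk_extension Hr t.
exists ti => //; have [x xP] := orbit_bases s.
pose f : {ffun 'I_r -> 'I_n} := [ffun k => blk_index Hr k].
have fE k : f k = ords n (f (s k)).
  by rewrite ordsnn !ffunE -(blkK Hr k) sE !blk_indexK.
have cyc i : perm_eq (cyctype (ti i)) (colour_cycles n 1 x f i).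
  apply: (cyctype_colour_class n0 (ltn0Sn 0) n1 fE (ltn_ord i) xP (@blk_inj _ _ _ Hr i)).
  - by move=> j; rewrite ffunE blk_indexK.
  - move=> k; rewrite ffunE => fk.
    by have /imsetP[j _ ->] : k \in blkset Hr i; [rewrite mem_blkset fk | exists j].
  by move=> j; rewrite expg1 sE.
have fEq : equivariant n s f by apply/equivariantP.
transitivity (\prod_(i < n) specht_char (lam (sh i)) (colour_cycles n 1 x f i)).
  by apply: eq_bigr => i _; apply: eq_specht_char.
transitivity (\prod_(i < n) specht_char (lam i) (colour_cycles n 1 x f i)); last first.
  by apply: eq_bigr => i _; apply: eq_specht_char; rewrite perm_sym.
rewrite -(eps_shift_coef xP fEq) [RHS](reindex_inj (@ords_inj n (d * b))) /=.
apply: eq_bigr => i _; congr (specht_char _ (map _ _)); apply: eq_filter => A.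
rewrite [in RHS]ffunE !modn_small //.
by apply/eqP/eqP => [/val_inj -> //|/val_inj/ords_inj ->].
Qed.

(** With t = 1 the products are nonzero, which gives the equality of sizes.  Letting
    t vary on one block shows that the Specht characters of lam_i and lam_(i+db) are
    proportional, so lam_i dominates lam_(i+db); the chain of these relations closes up. *)
(** Some exponent j that represents eps^b satisfies the isomorphism; take characters. *)
Lemma eps_invariant_shift u : lam (ords (d * b) u) = lam u.
Proof.
have szE i : psize (lam (sh i)) = c i.
  have [ti [t0 t1] E] := @eps_shift_blocks i 1%g.
  have tiE j : ti j = 1%g by have [->|/t1] := eqVneq j i.
  have : \prod_(i < n) specht_char (lam (sh i)) (cyctype (ti i)) != 0.
    by rewrite E; apply/prodf_neq0=> j _; rewrite tiE cyctype1 card_ord specht_char1_neq0.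
  move/prodf_neq0/(_ i isT)/specht_char_neq0 <-.
  by rewrite sumn_cyctype card_ord.
have dom i : dominates (lam i) (lam (sh i)).
  pose D := \prod_(j < n | j != i) specht_char (lam j) (nseq (c j) 1%N).
  pose D' := \prod_(j < n | j != i) specht_char (lam (sh j)) (nseq (c j) 1%N).
  apply: (@specht_dominance _ _ D D'); first exact: szE.
    by apply/prodf_neq0=> j _; apply: specht_char1_neq0.
  move=> t; have [ti [t0 t1]] := @eps_shift_blocks i t.
  rewrite (bigD1 i) //= [in RHS](bigD1 i) //= t0 [in RHS](specht_charE (perm_refl _)) => E.
  rewrite /D /D'; apply/esym; move: E.
  rewrite (eq_bigr (fun j => specht_char (lam (sh j)) (nseq (c j) 1%N))) => [|j ji]; last first.
    by rewrite t1 // cyctype1 card_ord.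
  rewrite [X in _ = _ * X](eq_bigr (fun j => specht_char (lam j) (nseq (c j) 1%N))) // => j ji.
  by rewrite t1 // cyctype1 card_ord.
have chain j i : dominates (lam i) (lam (ords (j * (d * b)) i)).
  elim: j => [|j IH]; first by move=> k.
  by rewrite mulSn -ordsD; apply: dominates_trans IH (dom _).
apply: dominates_anti; last exact: dom.
have := chain n.-1 (sh u); rewrite /sh ordsD -mulSnr prednK // (mulnC n (d * b)) ords_mul.
by [].
Qed.
End EpsInvariance.

Section EpsOrder.
Variables (d e r : nat).
Hypotheses (d0 : (0 < d)%N) (e0 : (0 < e)%N) (r0 : (0 < r)%N).

Lemma cfexpE k (phi : 'CF([set: wreath (d * e) r])) g : (phi ^+ k) g = phi g ^+ k.
Proof.
elim: k => [|k IH]; first by rewrite !expr0 cfun1E inE.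
by rewrite !exprS cfunE IH.
Qed.

Lemma cfRepr_eps j g : cfRepr (eps_repr d e r j) g = eps g ^+ j.
Proof. by rewrite cfunE inE mulr1n /= mxtrace_scalar mulr1n. Qed.

Lemma eps_charE g : eps_char d e r g = eps g.
Proof. by rewrite /eps_char cfRepr_eps expr1. Qed.

Lemma eps_expe (g : wreath (d * e) r) : eps g ^+ e = 1.
Proof.
rewrite /eps -exprM -prodrXl big1 // => k _.
by rewrite rootU_expn // muln_gt0 d0.
Qed.

Lemma eps_invariant (lam : multipart r (d * e)) b : in_C lam (eps_char d e r ^+ b) ->
  forall g, eps g ^+ b * cfRepr (W_repr lam) g = cfRepr (W_repr lam) g.
Proof.
case=> j Ej /cfRepr_sim sim g.
have : eps g ^+ b = eps g ^+ j.
  by have := congr1 (fun phi : 'CF(_) => phi g) Ej; rewrite !cfexpE eps_charE.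
move=> ->; rewrite -[in RHS]sim -cfRepr_prod -cfRepr_eps.
by rewrite [RHS]cfunE.
Qed.

Lemma eps_generator z : (d * e)%N.-primitive_root z ->
  exists g : wreath (d * e) r, eps g = z ^+ d.
Proof.
move=> zP; have n0 : (0 < d * e)%N by rewrite muln_gt0 d0.
have zU : z ^+ (d * e).-1.+1 == 1 by rewrite prednK // (prim_expr_order zP).
pose g : wreath (d * e) r :=
  Wreath [ffun k : 'I_r => if k == Ordinal r0 then RootU zU else 1%g] 1%g.
exists g; rewrite /eps (bigD1 (Ordinal r0)) //= ffunE eqxx /= big1 ?mulr1 // => k /negbTE nk.
by rewrite ffunE nk.
Qed.

Lemma card_powers b (C : 'CF([set: wreath (d * e) r]) -> Prop) N : (b %| e)%N ->
  (forall chi, C chi <-> exists k : nat, chi = (eps_char d e r ^+ b) ^+ k) ->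
  has_card C N -> N = (e %/ b)%N.
Proof.
move=> /dvdnP[a eE] CE [s [us <- sP]].
have b0 : (0 < b)%N by move: e0; rewrite eE muln_gt0 => /andP[].
have -> : (e %/ b)%N = a by rewrite eE mulnK.
have a0 : (0 < a)%N by move: e0; rewrite eE muln_gt0 => /andP[].
pose X := eps_char d e r ^+ b.
have Xa : X ^+ a = 1.
  rewrite -exprM (mulnC b a) -eE; apply/cfunP=> g.
  by rewrite cfexpE eps_charE eps_expe cfun1E inE.
suff E : perm_eq s [seq X ^+ k | k <- iota 0 a] by rewrite (perm_size E) size_map size_iota.
apply: uniq_perm => //.
  rewrite map_inj_in_uniq ?iota_uniq // => k l; rewrite !mem_iota /= => ka la E.
  have n0 : (0 < d * e)%N by rewrite muln_gt0 d0.
  have [z zP] := C_prim_root_exists n0.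
  have [g gE] := eps_generator zP.
  have /eqP := congr1 (fun phi : 'CF(_) => phi g) E.
  rewrite /= /X !cfexpE eps_charE gE -!exprM (eq_prim_root_expr zP) -!muln_modr.
  by rewrite eqn_pmul2l // eE (mulnC a) -!muln_modr eqn_pmul2l // !modn_small // => /eqP.
move=> chi; apply/idP/mapP => [/sP/CE[k ->]|[k _ ->]]; last by apply/sP/CE; exists k.
exists (k %% a)%N; first by rewrite mem_iota ltn_pmod.
by rewrite -/X expr_mod.
Qed.
End EpsOrder.

(** * Standard representatives and cyclic structures *)

(** A cycle of g is one of the intervals, and its first point carries the whole
    cycle product. *)
Lemma standard_bases n r (g : wreath n r) : standard_form g ->
  exists2 x : orb (ws g) -> 'I_r, forall A : orb (ws g), x A \in val A &
    forall (A : orb (ws g)) k, k \in val A -> k != x A -> wz g k = 1%g.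
Proof.
case=> s [l [Hl [l0 gs gz]]].
have idx k : blk_index Hl (ws g k) = blk_index Hl k.
  by rewrite -{1}(blkK Hl k) gs blk_indexK.
pose first j := blk Hl (Ordinal (l0 j)).
have firstP j a (la : (a < l j)%N) : blk Hl (Ordinal la) \in porbit (ws g) (first j).
  elim: a la => [|a IH] la.
    have -> : Ordinal la = Ordinal (l0 j) by apply: val_inj.
    exact: porbit_id.
  have la' := ltnW la; have -> : Ordinal la = ordS (Ordinal la').
    by apply: val_inj; rewrite /= modn_small.
  by rewrite -gs porbits_mem_perm ?mem_porbits.
have sameP k : first (blk_index Hl k) \in porbit (ws g) k.
  rewrite porbit_sym -{1}(blkK Hl k).
  by case: (blk_pos Hl k) => a la; apply: firstP.
have ex (A : orb (ws g)) : exists k,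
    (k \in val A) && [forall l, (l \in val A) && (l != k) ==> (wz g l == 1%g)].
  have [k0 Ak0] := porbits_neq0 (valP A); have vA := porbitsE (valP A) Ak0.
  exists (first (blk_index Hl k0)).
  rewrite {1}vA sameP; apply/forallP=> k.
  apply/implyP=> /andP[Ak nk].
  have idk : blk_index Hl k = blk_index Hl k0.
    move: Ak; rewrite vA => /porbitP[a ->].
    by elim: a => [|a IH]; rewrite ?perm1 // expgSr permM idx.
  rewrite -(blkK Hl k) gz // lt0n; apply: contraNneq nk => p0.
  by apply/eqP/(@blk_eq _ _ _ Hl); rewrite /first ?blk_indexK ?blk_posK.
exists (fun A => xchoose (ex A)) => [A|A k Ak nk].
  by case/andP: (xchooseP (ex A)).
by case/andP: (xchooseP (ex A)) => _ /forallP/(_ k)/implyP H; apply/eqP/H; rewrite Ak.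
Qed.

Lemma standard_scalars n r (g : wreath n r) (x : orb (ws g) -> 'I_r)
    (f : {ffun 'I_r -> 'I_n}) :
  (forall A, x A \in val A) ->
  (forall (A : orb (ws g)) k, k \in val A -> k != x A -> wz g k = 1%g) ->
  \prod_k rootU_val (wz g k) ^+ f k = \prod_A cycprod g (val A) ^+ f (x A).
Proof.
move=> xP z1; rewrite (big_orb (ws g)); apply: eq_bigr => A _.
rewrite /cycprod (bigD1 (x A)) //= [in RHS](bigD1 (x A)) //=.
rewrite big1 ?[X in (_ * X) ^+ _]big1 ?mulr1 // => k /andP[Ak nk].
  by rewrite (z1 A).
by rewrite (z1 A) //= expr1n.
Qed.

Section CycleStructure.
Variables (n r : nat) (zeta : algC) (eta : {ffun 'I_n -> intpart}) (g : wreath n r).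
Hypotheses (zP : n.-primitive_root zeta) (gP : has_cycstruct zeta eta g).
Let n0 : (0 < n)%N := prim_order_gt0 zP.

Lemma cycprod_zeta A : exists u : 'I_n, cycprod g A = zeta ^+ u.
Proof. by have /(prim_rootP zP)[u ->] := cycprod_root g A n0; exists u. Qed.

Lemma zeta_inj (u v : 'I_n) : (zeta ^+ u == zeta ^+ v) = (u == v).
Proof. by rewrite (eq_prim_root_expr zP) !modn_small. Qed.

Lemma cycle_length_in A (u : 'I_n) : A \in porbits (ws g) -> cycprod g A = zeta ^+ u ->
  #|A| \in (eta u : seq nat).
Proof.
move=> sA Au; rewrite (perm_mem (gP u)); apply/mapP; exists A => //.
by rewrite mem_filter mem_enum sA Au eqxx.
Qed.

Lemma part_cycle u l : l \in (eta u : seq nat) ->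
  exists2 A, A \in porbits (ws g) & l = #|A|.
Proof.
rewrite (perm_mem (gP u)) => /mapP[A]; rewrite mem_filter mem_enum => /andP[_ sA] ->.
by exists A.
Qed.

Lemma count_cycles (P : pred nat) (u : 'I_n) :
  count (fun A : {set 'I_r} => P #|A| && (cycprod g A == zeta ^+ u)) (enum (porbits (ws g))) =
  count P (eta u).
Proof.
rewrite (seq.permP (gP u)) count_map count_filter; apply: eq_count => A /=.
by [].
Qed.

Lemma part_length_cycles : part_length eta = #|{: orb (ws g)}|.
Proof.
rewrite card_orb /part_length.
transitivity (\sum_(A in porbits (ws g)) \sum_(u < n) (cycprod g A == zeta ^+ u))%N.
  rewrite exchange_big /=; apply: eq_bigr => u _.
  rewrite -(count_predT (eta u)) -count_cycles -sum1_count big_mkcond big_enum /=.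
  by apply: eq_bigr => A _; case: eqP.
rewrite -sum1_card; apply: eq_bigr => A _.
have [u ->] := cycprod_zeta A.
by rewrite (bigD1 u) //= eqxx big1 ?addn0 // => v; rewrite zeta_inj eq_sym => /negbTE ->.
Qed.
End CycleStructure.

(** The cyclic structures count the cycles of given length and product on both sides. *)
Lemma cycles_bij n r r' q (zeta : algC) (eta eta' : {ffun 'I_n -> intpart})
    (g : wreath n r) (g' : wreath n r') :
  n.-primitive_root zeta -> (0 < q)%N ->
  has_cycstruct zeta eta g -> has_cycstruct zeta eta' g' ->
  (forall u, eta u = qstar q (eta' u) :> seq nat) ->
  exists2 h : orb (ws g) -> orb (ws g'), bijective h &
    forall A, cycprod g' (val (h A)) = cycprod g (val A) /\
              #|val (h A)| = (#|val A| %/ q)%N.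
Proof.
move=> zP q0 gP gP' E.
pose F (A : {set 'I_r}) := (#|A| %/ q, cycprod g A)%N.
pose F' (A : {set 'I_r'}) := (#|A|, cycprod g' A).
have PE : perm_eq (map F (enum (porbits (ws g)))) (map F' (enum (porbits (ws g')))).
  apply/allP=> v v_in; have [l [u ->]] : exists l (u : 'I_n), v = (l, zeta ^+ u).
    move: v_in; rewrite mem_cat => /orP[] /mapP[A _ ->].
      by have [u uE] := cycprod_zeta g zP A; exists (#|A| %/ q)%N, u; rewrite -uE.
    by have [u uE] := cycprod_zeta g' zP A; exists #|A|, u; rewrite -uE.
  rewrite /= !count_map; apply/eqP.
  transitivity (count (fun x => x %/ q == l)%N (eta u)).
    by rewrite -(count_cycles gP); apply: eq_count => A; rewrite /= xpair_eqE.
  rewrite E count_map; transitivity (count (pred1 l) (eta' u)).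
    by apply: eq_count => y /=; rewrite mulKn.
  by rewrite -(count_cycles gP'); apply: eq_count => A; rewrite /= xpair_eqE.
have [h0 [h_in h_inj hF]] := perm_eq_bij set0 (enum_uniq _) (enum_uniq _) PE.
have hin (A : orb (ws g)) : h0 (val A) \in porbits (ws g').
  by rewrite -mem_enum h_in // mem_enum (valP A).
pose h (A : orb (ws g)) : orb (ws g') := exist _ (h0 (val A)) (hin A).
exists h => [|A]; last first.
  by have : F' (h0 (val A)) = F (val A) by [rewrite hF // mem_enum (valP A)]; case=> -> ->.
apply: inj_card_bij => [A B /(congr1 val) /= hAB|].
  by apply: val_inj; apply: h_inj hAB; rewrite mem_enum; apply: valP.
by rewrite !card_orb !cardE -(size_map F') -(perm_size PE) size_map.
Qed.

Lemma dvd_parts_qstar q (p : intpart) : (0 < q)%N ->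
  (forall l, l \in (p : seq nat) -> (q %| l)%N) ->
  exists p' : intpart, p = qstar q p' :> seq nat.
Proof.
move=> q0 qp; have E : [seq q * x | x <- [seq x %/ q | x <- p]]%N = p.
  rewrite -map_comp -[RHS]map_id; apply/eq_in_map=> l lp /=.
  by rewrite mulnC divnK // qp.
have P : sorted geq [seq x %/ q | x <- p]%N && (0%N \notin [seq x %/ q | x <- p]%N).
  case/andP: (pvalP p) => srt nz; apply/andP; split.
    by apply: homo_sorted srt => a b /= ba; apply: leq_div2r.
  apply/negP=> z; case/negP: nz; rewrite -E; apply/mapP; exists 0%N => //.
  by rewrite muln0.
by exists (IntPart P).
Qed.

Lemma psize_qfold n m q (lam : 'I_n -> intpart) :
  (0 < m)%N -> forall (q0 : (0 < q)%N) (nE : n = (q * m)%N),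
  (forall u, lam (ords m u) = lam u) ->
  (\sum_u psize (lam u) = q * \sum_(i < m) psize (lam (low_ord q0 nE i)))%N.
Proof.
move=> m0 q0 nE lamE; rewrite (reindex _ (onW_bij _ (ords_low_ord_bij m0 q0 nE))) /=.
rewrite -(pair_bigA _ (fun (i : 'I_m) (a : 'I_q) =>
  psize (lam (ords (a * m) (low_ord q0 nE i))))) /=.
rewrite big_distrr; apply: eq_bigr => i _ /=.
rewrite (eq_bigr (fun=> psize (lam (low_ord q0 nE i)))) => [|a _].
  by rewrite sum_nat_const card_ord.
by rewrite (ords_invariant lamE).
Qed.

Theorem theorem3p7 (d e r : nat) (zeta : algC)
    (lam eta : multipart r (d * e)) (b b' nC q : nat) (g : wreath (d * e) r) :
  (0 < d)%N -> (0 < e)%N -> (0 < r)%N ->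
  (d * e)%N.-primitive_root zeta ->
  (b %| e)%N ->
  (forall chi : 'CF([set: wreath (d * e) r]),
     in_C lam chi <-> exists k : nat, chi = (eps_char d e r ^+ b) ^+ k) ->
  has_card (in_C lam) nC ->
  (b' %| nC)%N ->
  q = (nC %/ b')%N ->
  standard_rep zeta eta g ->
  ((exists u : 'I_(d * e), ~ exists p : intpart, eta u = qstar q p :> seq nat) \/
   (exists2 A : {set 'I_r}, A \in porbits (ws g) &
                            cycprod g A ^+ (d * b * b') != 1) ->
   Delta lam b b' g = 0) /\
  (exists (r' : nat) (mu : multipart r' (d * e)),
     [/\ r = (q * r')%N,
         mval mu = head_part (d * b * b') lam,
         forall i j : 'I_(d * e), i = j %[mod d * b * b'] -> lam i = lam j
       & forall (eta' : {ffun 'I_(d * e) -> intpart}) (g' : wreath (d * e) r'),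
           (forall u : 'I_(d * e), eta u = qstar q (eta' u) :> seq nat) ->
           (forall A : {set 'I_r}, A \in porbits (ws g) ->
                                   cycprod g A ^+ (d * b * b') = 1) ->
           has_cycstruct zeta eta' g' ->
           Delta lam b b' g =
             q%:R ^+ part_length eta * cfRepr (W_repr mu) g']).
Proof.
move=> d0 e0 r0 zP be CE cardC b'C qE [gP /standard_bases[x xP z1]].
have n0 : (0 < d * e)%N by rewrite muln_gt0 d0.
have lamb : forall u, lam (ords (d * b) u) = lam u.
  by apply: (eps_invariant_shift n0); apply: eps_invariant; apply/CE; exists 1%N.
have nCE := card_powers d0 e0 r0 be CE cardC.
have eE : e = (q * b' * b)%N by rewrite qE divnK // nCE divnK.
rewrite [(d * b * b')%N]mulnC; set m := (b' * (d * b))%N.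
have nE : (d * e = q * m)%N by rewrite /m eE -mulnA mulnCA; congr (_ * _)%N; apply: mulnCA.
have [q0 m0] : (0 < q)%N /\ (0 < m)%N.
  by apply/andP; rewrite -muln_gt0 -nE.
have lamE := ords_invariant lamb b'; rewrite -/m in lamE.
have DE : Delta lam b b' g =
  if [forall A : orb (ws g), q %| #|val A|]%N &&
     [forall A : orb (ws g), cycprod g (val A) ^+ m == 1]
  then q%:R ^+ #|{: orb (ws g)}| *
       colour_sum (fun A : orb (ws g) => cycprod g (val A)) m
         (fun A : orb (ws g) => #|val A| %/ q)%N lam
  else 0.
  rewrite (Delta_shift_trace lamb); apply: (shift_trace_cycles m0 q0 nE _ xP).
  by move=> f _; apply: standard_scalars.
split.
  move=> H; rewrite DE; case: ifP => // /andP[/forallP qA /forallP rA].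
  case: H => [[u []]|[A sA]]; last by rewrite (eqP (rA (exist _ A sA))) eqxx.
  apply: dvd_parts_qstar => // l /(part_cycle gP)[A sA ->].
  exact: (qA (exist _ A sA)).
pose r' := (\sum_(u < d * e) psize (head_part m lam u))%N.
pose mu : multipart r' (d * e) := Multipart (eqxx r').
exists r', mu; split=> //.
- rewrite -[LHS](eqP (mvalP lam)) (psize_qfold m0 q0 nE lamE); congr (_ * _)%N.
  rewrite /r' (bigID (fun u : 'I_(d * e) => u < m)%N) /= [X in (_ + X)%N]big1 ?addn0.
    rewrite (big_ord_narrow (leq_modulus q0 nE)); apply: eq_bigr => i _.
    by rewrite ffunE /= ltn_ord.
  by move=> u um; rewrite ffunE (negbTE um) /psize big_ord0.
- move=> i j ij; rewrite -(ord_res_quo m0 q0 nE i) -(ord_res_quo m0 q0 nE j).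
  rewrite !(ords_invariant lamE); by congr (lam (low_ord _ _ _)); apply: val_inj.
move=> eta' g' etaE rA gP'.
have qA A : A \in porbits (ws g) -> (q %| #|A|)%N.
  move=> sA; have [u Au] := cycprod_zeta g zP A.
  have := cycle_length_in gP sA Au; rewrite etaE => /mapP[y _ ->].
  exact: dvdn_mulr.
rewrite DE ifT; last first.
  by apply/andP; split; apply/forallP=> -[A sA] /=; [apply: qA | rewrite rA].
rewrite (part_length_cycles zP gP); congr (_ * _).
rewrite cfRepr_cycles // (_ : mval mu = head_part m lam) //.
rewrite (colour_sum_head _ q0 nE).
have [h h_bij hE] := cycles_bij zP q0 gP gP' etaE.
by apply: (@colour_sum_bij _ _ _ _ _ _ _ _ _ h) => // A; have [] := hE A.
Qed.
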